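(* Let $\alpha\in(1,2]$, $d<\beta<\alpha d$, $\gamma=\beta/d\in(1,\alpha)$, $\sigma_\gamma>0$ and $b_\gamma\in[-1,1]$, and let $\widetilde Z_\gamma(\mu)=\int_{\mathbb{R}^d}\phi(x)\,\widetilde M_\gamma(dx)$ for $\mu(dx)=\phi(x)\,dx$ with $\phi\in L^1(\mathbb{R}^d)\cap L^\alpha(\mathbb{R}^d)$, where $\widetilde M_\gamma$ is a $\gamma$-stable random measure on $\mathbb{R}^d$ with control measure $\sigma_\gamma^\gamma\,dx$ and constant skewness $b_\gamma$, the constants $\sigma_\gamma,b_\gamma$ being those given in the context. Then the field $\widetilde Z_\gamma$ is stationary, isotropic and self-similar with index $(d-\beta)/\gamma$. That is, indexing by all $\mu\in L^1(\mathbb{R}^d)\cap L^\alpha(\mathbb{R}^d)$: for every $s\in\mathbb{R}^d$, $\Theta\in\mathcal{O}(\mathbb{R}^d)$ and $a>0$, the fields $(\widetilde Z_\gamma(\tau_s\mu))_\mu$ and $(\widetilde Z_\gamma(\Theta\mu))_\mu$ have the same finite-dimensional distributions as $(\widetilde Z_\gamma(\mu))_\mu$, and $(\widetilde Z_\gamma(\mu_a))_\mu$ has the same finite-dimensional distributions as $(a^{(d-\beta)/\gamma}\widetilde Z_\gamma(\mu))_\mu$.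
   Context: $d\ge1$ is an integer, $c_d$ is the Lebesgue volume of the Euclidean unit ball of $\mathbb{R}^d$, $\mathcal{O}(\mathbb{R}^d)$ is the orthogonal group, and $\varepsilon(a)=1,-1,0$ according to $a>0$, $a<0$, $a=0$. By abuse of notation, $\mu\in L^1(\mathbb{R}^d)\cap L^\alpha(\mathbb{R}^d)$ means $\mu(dx)=\phi(x)\,dx$ with $\phi\in L^1(\mathbb{R}^d)\cap L^\alpha(\mathbb{R}^d)$. For Borel $A$: $\tau_s\mu(A)=\mu(A-s)$, $\Theta\mu(A)=\mu(\Theta^{-1}A)$, $\mu_a(A)=\mu(a^{-1}A)$. For a $\gamma$-stable random measure $M$ with control measure $m$ and constant skewness $b'$ and $h\in L^\gamma(m)$, the stable integral $\int h\,dM$ is well defined, linear in $h$, with characteristic function $\theta\mapsto\exp\big(-\int|\theta h|^\gamma(1-ib'\varepsilon(\theta h)\tan(\pi\gamma/2))\,dm\big)$. Constants: for a constant $C_\beta>0$ and a probability measure $G$ on $\mathbb{R}$, $\sigma_\gamma^\gamma=\frac{c_d^\gamma C_\beta}{d}\int_0^{+\infty}\frac{1-\cos r}{r^{1+\gamma}}dr\int_{\mathbb{R}}|m|^\gamma G(dm)$ and $b_\gamma=\frac{\int_{\mathbb{R}}\varepsilon(m)|m|^\gamma G(dm)}{\int_{\mathbb{R}}|m|^\gamma G(dm)}$, where $G$ is in the normal domain of attraction of an $\alpha$-stable law in the sense that for some $\sigma>0$, $b\in[-1,1]$, $\tau\in\mathbb{R}$, its characteristic function satisfies $\varphi_G(\theta)=1+i\theta\tau-\sigma^\alpha|\theta|^\alpha(1-ib\,\varepsilon(\theta)\tan(\pi\alpha/2))+o(|\theta|^\alpha)$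 as $\theta\to0$ (so that $0<\int|m|^\gamma G(dm)<\infty$). *)

(* Defs.v *)
From HB Require Import structures.
From mathcomp Require Import all_boot all_order all_algebra.
From mathcomp Require Import all_classical all_reals all_analysis.
From mathcomp Require Import measurable_realfun.
From mathcomp Require Import complex.

Set Implicit Arguments.
Unset Strict Implicit.
Unset Printing Implicit Defensive.

Import Order.TTheory GRing.Theory Num.Theory.
Import numFieldNormedType.Exports.
Import HBSimple.

Local Open Scope classical_set_scope.
Local Open Scope ring_scope.

(* R^d is [d.-tuple R] with the product sigma-algebra of the Borel
   sigma-algebra of R, i.e. the Borel sigma-algebra of R^d. *)

Section lebesgue_tuple.
Context {R : realType}.

Definition tuple_cons d (x : measurableTypeR R * d.-tuple R) : d.+1.-tuple R :=
  [tuple of x.1 :: x.2].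

Lemma measurable_tuple_cons d : measurable_fun setT (@tuple_cons d).
Proof.
apply: measurable_cons; last exact: measurable_snd.
exact: (@measurable_fst _ _ (measurableTypeR R) (d.-tuple R)).
Qed.

HB.instance Definition _ d :=
  @isMeasurableFun.Build _ _ _ _ (@tuple_cons d) (@measurable_tuple_cons d).

Section cons_measure.
Context d (m : {sigma_finite_measure set (d.-tuple R) -> \bar R}).

Definition cons_measure : set (d.+1.-tuple R) -> \bar R :=
  pushforward (lebesgue_measure \x m)%E (@tuple_cons d).

Let cons_measure0 : cons_measure set0 = 0%E.
Proof. by rewrite /cons_measure /pushforward preimage_set0 measure0. Qed.

Let cons_measure_ge0 A : (0 <= cons_measure A)%E.
Proof. exact: measure_ge0. Qed.

Let cons_measure_sigma_additive : semi_sigma_additive cons_measure.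
Proof.
pose p := measure_function_pushforward__canonical__measure_function_Measure
  (lebesgue_measure \x m)%E (@measurable_tuple_cons d).
exact: (@measure_semi_sigma_additive _ _ _ p).
Qed.

HB.instance Definition _ := isMeasure.Build _ _ _ cons_measure
  cons_measure0 cons_measure_ge0 cons_measure_sigma_additive.

Let cons_measure_sigma_finite : sigma_finite setT cons_measure.
Proof.
have /sigma_finiteP[F [TF ndF Foo]] := sigma_finiteT (@lebesgue_measure R).
have /sigma_finiteP[G [TG ndG Goo]] := sigma_finiteT m.
pose u (y : d.+1.-tuple R) : measurableTypeR R * d.-tuple R :=
  (thead y, [tuple of behead y]).
have uK : cancel (@tuple_cons d) u.
  by case=> a t; rewrite /u /tuple_cons theadE /=; congr (_, _); exact/val_inj.
have mu : measurable_fun setT u.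
  apply: measurable_fun_pair; last exact: measurable_behead.
  exact: (@measurable_tnth _ R d.+1 ord0).
exists (fun n => u @^-1` (F n `*` G n)).
  apply/esym; rewrite -subTset => y _.
  have : setT (u y).1 by []. rewrite TF => -[n _ Fn].
  have : setT (u y).2 by []. rewrite TG => -[k _ Gk].
  exists (maxn n k) => //; split.
    by move: (u y).1 Fn; exact/subsetPset/ndF/leq_maxl.
  by move: (u y).2 Gk; exact/subsetPset/ndG/leq_maxr.
move=> n; have [mF Fn] := Foo n; have [mG Gn] := Goo n; split.
  by rewrite -[X in measurable X]setTI; apply: mu => //; exact: measurableX.
rewrite /cons_measure /pushforward -comp_preimage.
have -> : u \o @tuple_cons d = id by apply/funext => x; rewrite /= uK.
by rewrite preimage_id product_measure1E// lte_mul_pinfty// ge0_fin_numE.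
Qed.

HB.instance Definition _ := @Measure_isSigmaFinite.Build _ _ _ cons_measure
  cons_measure_sigma_finite.

End cons_measure.

(* Lebesgue measure on R^d as an iterated product; see [lebesgue_tuple_box]. *)
Fixpoint lebesgue_tuple d : {sigma_finite_measure set (d.-tuple R) -> \bar R} :=
  match d with
  | 0 => @dirac _ _ [tuple] R
  | d'.+1 => cons_measure (lebesgue_tuple d')
  end.

Lemma lebesgue_tuple_box d (A : 'I_d -> set (measurableTypeR R)) :
  (forall i, measurable (A i)) ->
  lebesgue_tuple d [set x | forall i, A i (tnth x i)] =
  (\prod_(i < d) lebesgue_measure (A i))%E.
Proof.
elim: d A => [|d IHd] A mA.
  rewrite big_ord0 /= /dirac; set B := (X in \1_X).
  by rewrite indicE mem_set// => -[].
rewrite big_ord_recl /= /cons_measure /pushforward.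
have -> : @tuple_cons d @^-1` [set x | forall i, A i (tnth x i)] =
    A ord0 `*` [set x | forall i, A (lift ord0 i) (tnth x i)].
  apply/seteqP; split => [[a t]/= h|[a t]/= [h0 h] i].
    split=> [|i]; first exact: (h ord0).
    by move: (h (lift ord0 i)); rewrite tnthS.
  by case: (unliftP ord0 i) => [j ->|->//]; rewrite tnthS.
rewrite product_measure1E//; first by congr (_ * _)%E; apply: IHd => i; exact: mA.
have -> : [set x : d.-tuple R | forall i, A (lift ord0 i) (tnth x i)] =
    \bigcap_(i in [set: 'I_d]) ((@tnth _ R ^~ i) @^-1` A (lift ord0 i)).
  by apply/seteqP; split => x /= h i => [_|]; exact: h.
apply: fin_bigcap_measurable => // i _; rewrite -[X in measurable X]setTI.
by apply: measurable_tnth => //; exact: mA.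
Qed.

End lebesgue_tuple.
Arguments lebesgue_tuple : clear implicits.

Section euclidean.
Context {R : realType} {d : nat}.
Local Notation E := (d.-tuple R).

Definition euclidean_norm (x : E) : R := Num.sqrt (\sum_(i < d) tnth x i ^+ 2).

Definition unit_ball : set E := [set x | euclidean_norm x <= 1].

Definition translation (s : E) (x : E) : E :=
  [tuple tnth x i + tnth s i | i < d].

Definition dilation (a : R) (x : E) : E := [tuple a * tnth x i | i < d].

Definition mx_map (A : 'M[R]_d) (x : E) : E :=
  [tuple \sum_(j < d) A i j * tnth x j | i < d].

Definition orthogonal_group : set 'M[R]_d := [set A | A^T *m A = 1%:M].

Lemma measurable_translation s : measurable_fun setT (translation s).
Proof.
apply/measurable_fun_tnthP => i.
apply: (eq_measurable_fun (fun x : E => tnth x i + tnth s i)).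
  by move=> x _; rewrite /= tnth_mktuple.
by apply: measurable_funD => //; exact: measurable_tnth.
Qed.

Lemma measurable_dilation a : measurable_fun setT (dilation a).
Proof.
apply/measurable_fun_tnthP => i.
apply: (eq_measurable_fun (fun x : E => a * tnth x i)).
  by move=> x _; rewrite /= tnth_mktuple.
by apply: measurable_funM => //; exact: measurable_tnth.
Qed.

Lemma measurable_mx_map A : measurable_fun setT (mx_map A).
Proof.
apply/measurable_fun_tnthP => i.
apply: (eq_measurable_fun (fun x : E => \sum_(j < d) A i j * tnth x j)).
  by move=> x _; rewrite /= tnth_mktuple.
apply: measurable_sum => j.
by apply: measurable_funM => //; exact: measurable_tnth.
Qed.

HB.instance Definition _ s := @isMeasurableFun.Build _ _ _ _
  (translation s) (measurable_translation s).
HB.instance Definition _ a := @isMeasurableFun.Build _ _ _ _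
  (dilation a) (measurable_dilation a).
HB.instance Definition _ A := @isMeasurableFun.Build _ _ _ _
  (mx_map A) (measurable_mx_map A).

End euclidean.

Section charge_image.
Context {d1 d2} {T1 : measurableType d1} {T2 : measurableType d2} {R : realType}.
Variables (f : {mfun T1 >-> T2}) (mu : {charge set T1 -> \bar R}).

Definition charge_image : set T2 -> \bar R := pushforward mu f.

Let p : {charge set T2 -> \bar R} :=
  measure_function_pushforward__canonical__charge_Charge mu (measurable_funPT f).

Let charge_image0 : charge_image set0 = 0%E.
Proof. exact: (charge0 p). Qed.

Let charge_image_finite A : measurable A -> charge_image A \is a fin_num.
Proof. exact: (@fin_num_measure _ _ _ p). Qed.

Let charge_image_sigma_additive : semi_sigma_additive charge_image.
Proof. exact: (@charge_semi_sigma_additive _ _ _ p). Qed.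

HB.instance Definition _ := isCharge.Build _ _ _ charge_image
  charge_image0 charge_image_finite charge_image_sigma_additive.

End charge_image.

Section complex_exponential.
Context {R : realType}.
Local Open Scope complex_scope.

Definition cexp (z : R[i]) : R[i] :=
  (expR (complex.Re z))%:C *
  (cos (complex.Im z) +i* sin (complex.Im z)).

Definition char_fun (G : {measure set R -> \bar R}) (theta : R) : R[i] :=
  (\int[G]_x cos (theta * x)) +i* (\int[G]_x sin (theta * x)).

(* |theta|^gamma (1 - i b sgn(theta) tan(pi gamma / 2)) *)
Definition stable_exponent (gamma b theta : R) : R[i] :=
  (`|theta| `^ gamma)%:C *
  (1 - 'i%C * (b * Num.sg theta * tan (pi * gamma / 2))%:C).

Definition normal_domain_of_attraction (alpha : R) (G : probability R R) :=
  exists sigma b tau : R,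
    [/\ 0 < sigma, -1 <= b <= 1 &
      (fun theta => ComplexField.Normc.normc
         (char_fun G theta -
          (1 + 'i%C * (theta * tau)%:C
             - (sigma `^ alpha)%:C * stable_exponent alpha b theta)))
      =o_ (0 : R) (fun theta => `|theta| `^ alpha)].

End complex_exponential.

Section probability.
Context {dO} {Omega : measurableType dO} {R : realType}.
Variable P : probability Omega R.

Definition mutually_independent n (X : 'I_n -> {RV P >-> R}) :=
  forall B : 'I_n -> set R, (forall i, measurable (B i)) ->
  P (\bigcap_(i in [set: 'I_n]) X i @^-1` B i) =
  (\prod_(i < n) P (X i @^-1` B i))%E.

Definition cvg_in_probability (X : {RV P >-> R}^nat) (Y : {RV P >-> R}) :=
  forall e : R, 0 < e ->
  P [set w | e <= `|X n w - Y w|] @[n --> \oo] --> 0%E.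

Definition joint_law n (X : 'I_n -> Omega -> R) : set (n.-tuple R) -> \bar R :=
  pushforward P (fun w => [tuple X i w | i < n]).

(* Fields indexed by the set [D]. *)
Definition same_fdd I (D : set I) (X Y : I -> Omega -> R) :=
  forall n (t : 'I_n -> I), (forall i, D (t i)) ->
  forall B, measurable B ->
  joint_law (fun i => X (t i)) B = joint_law (fun i => Y (t i)) B.

Section stable_random_measure.
Context {d} {T : measurableType d}.
Variables (gamma b : R) (m : {measure set T -> \bar R}).

Definition finite_control (A : set T) := measurable A /\ (m A < +oo)%E.

(* The values of [M] outside of [finite_control] are irrelevant. *)
Record stable_random_measure (M : set T -> {RV P >-> R}) : Prop := {
  srm_independently_scattered : forall n (A : 'I_n -> set T),
    (forall i, finite_control (A i)) -> trivIset setT A ->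
    mutually_independent (fun i => M (A i)) ;
  srm_sigma_additive : forall A : (set T)^nat,
    (forall k, finite_control (A k)) -> trivIset setT A ->
    finite_control (\bigcup_k A k) ->
    {ae P, forall w, (\sum_(0 <= k < n) M (A k) w) @[n --> \oo] -->
                     (M (\bigcup_k A k) w : R)} ;
  srm_char_fun : forall A, finite_control A -> forall theta : R,
    char_fun (distribution P (M A)) theta =
    cexp (- ((fine (m A))%:C%C * stable_exponent gamma b theta)) }.

Definition simple_integrand (h : {sfun T >-> R}) :=
  forall c : R, c != 0 -> (m (h @^-1` [set c]) < +oo)%E.

Definition simple_stable_integral (M : set T -> {RV P >-> R})
    (h : {sfun T >-> R}) (w : Omega) : R :=
  \sum_(c \in range h) c * M (h @^-1` [set c]) w.

(* [X] is a version of [\int h dM], the limit in probability of the integrals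
   of simple functions converging to [h] in [L^gamma(m)]. *)
Definition is_stable_integral (M : set T -> {RV P >-> R}) (h : T -> R)
    (X : {RV P >-> R}) :=
  h \in Lfun m gamma%:E /\
  exists (g : {sfun T >-> R}^nat) (Y : {RV P >-> R}^nat),
    [/\ forall n, simple_integrand (g n),
        Lnorm m gamma%:E (EFin \o (g n \- h)) @[n --> \oo] --> 0%E,
        forall n, Y n =1 simple_stable_integral M (g n) &
        cvg_in_probability Y X].

End stable_random_measure.
End probability.

Section signed_measures.
Context {R : realType} {d : nat}.

(* [mu (dx) = phi x dx] with [phi] in L^1 and L^alpha; the values of a charge on
   nonmeasurable sets are irrelevant. *)
Definition has_density (alpha : R) (mu : {charge set (d.-tuple R) -> \bar R})
    (phi : d.-tuple R -> R) :=
  [/\ phi \in Lfun (lebesgue_tuple R d) 1%E,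
      phi \in Lfun (lebesgue_tuple R d) alpha%:E &
      forall A, measurable A ->
        mu A = (\int[lebesgue_tuple R d]_(x in A) (phi x)%:E)%E].

(* The signed measures belonging to L^1(R^d) and L^alpha(R^d). *)
Definition L1_Lalpha (alpha : R) : set ({charge set (d.-tuple R) -> \bar R}) :=
  [set mu | exists phi, has_density alpha mu phi].

End signed_measures.

Section fields.
Context {dO} {Omega : measurableType dO} {R : realType}.
Variables (P : probability Omega R) (d : nat).
Local Notation signed_measure := ({charge set (d.-tuple R) -> \bar R}).
Variables (D : set signed_measure) (Z : signed_measure -> {RV P >-> R}).

(* The image charge under [f] maps [A] to [mu (f @^-1` A)]; the preimages of [A]
   under [translation s], [mx_map Theta] and [dilation a] are A - s,
   Theta^-1 A and a^-1 A. *)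
Definition stationary :=
  forall s : d.-tuple R,
    same_fdd P D (fun mu => Z (charge_image (translation s) mu)) Z.

Definition isotropic :=
  forall Theta : 'M[R]_d, orthogonal_group Theta ->
    same_fdd P D (fun mu => Z (charge_image (mx_map Theta) mu)) Z.

Definition self_similar (H : R) :=
  forall a : R, 0 < a ->
    same_fdd P D (fun mu => Z (charge_image (dilation a) mu))
                 (fun mu w => a `^ H * Z mu w).

End fields.

Section constants.
Context {R : realType}.
Variables (d : nat) (C_beta gamma : R) (G : probability R R).

Definition unit_ball_volume : R := fine (lebesgue_tuple R d unit_ball).

(* [sigma_gamma `^ gamma] is the constant in front of [`^ gamma^-1] below. *)
Definition sigma_gamma : R :=
  (unit_ball_volume `^ gamma * C_beta / d%:R *
   (\int[lebesgue_measure]_(r in `]0, +oo[) ((1 - cos r) / r `^ (1 + gamma))) *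
   (\int[G]_x (`|x| `^ gamma))) `^ gamma^-1.

Definition b_gamma : R :=
  (\int[G]_x (Num.sg x * `|x| `^ gamma)) / (\int[G]_x (`|x| `^ gamma)).

(* sigma_gamma^gamma dx *)
Definition control_measure : {measure set (d.-tuple R) -> \bar R} :=
  mscale (NngNum (powR_ge0 sigma_gamma gamma)) (lebesgue_tuple R d).

End constants.

(* Main.v *)
Require Import Defs.
From HB Require Import structures.
From mathcomp Require Import all_boot all_order all_algebra.
From mathcomp Require Import all_classical all_reals all_analysis.
From mathcomp Require Import measurable_realfun.
From mathcomp Require Import complex.
From mathcomp Require Import ring lra.

(** The law of a stable integral depends on the integrand h only through the
    masses int (h^+)^gamma dm and int (h^-)^gamma dm: the characteristic
    function of int h dM is
      exp (- (A+ + A-) + i b tan (pi gamma / 2) (A+ - A-)),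
    where A+ and A- are these two masses.  Since the integral is linear in h,
    the joint characteristic function of Z mu_1, ..., Z mu_n at theta is the
    same expression for h = sum_i theta_i phi_i
    ([stable_integral_cos_law]), and it determines the joint law
    ([eq_measure_of_cos]).

    Let f be a bijection of R^d with Lebesgue measure of f^-1 A equal to kappa
    times that of A.  If mu has density phi, its image under f has density
    kappa phi o f^-1 ([has_density_image]), and a change of variables shows
    that passing from h to kappa h o f^-1 multiplies both masses by
    kappa^(gamma - 1).  So does multiplying h by kappa^(1 - 1 / gamma), hence
    the fields Z (f mu) and kappa^(1 - 1 / gamma) Z mu have the same
    finite-dimensional distributions ([image_same_fdd]).  Translations and
    orthogonal maps have kappa = 1.  The dilation by a has kappa = a^-d, and
    a^(-d (1 - 1 / gamma)) = a^((d - beta) / gamma) because beta = d gamma.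

    Characteristic functions are handled in real form: E e^(iX) = e^(-a + ip)
    is the assertion that E cos (X + c) = e^-a cos (p + c) for every phase c
    ([cos_law]).  Three ingredients need a proof of their own.

    Uniqueness.  The bounded functions g on R^n for which
    int cos (theta . x + c) g (x) is the same for two probability measures, for
    all theta and c, form a vector space closed under bounded pointwise limits
    and, by the product formula for cos A sin B, under multiplication by
    sin (theta . x + c).  It is therefore closed under multiplication by
    polynomials in such a sine, then by the indicator of its negativity set,
    then by the indicator of x_i < a, and finally by the indicator of every
    Borel set.

    The law of the integral.  Finitely many simple integrands are constant on
    the cells of a common finite partition, so a linear combination of their
    integrals is almost surely a sum of independent stable variables
    ([simple_cos_law]).  The two masses are gamma-th powers of norms of h^+ and
    h^- in L^gamma, which by Minkowski's inequality are continuous in h; and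
    E cos is continuous for convergence in probability.

    Invariance of Lebesgue measure under an orthogonal map Theta.  With B the
    unit ball, the measure of the pairs (x, y) such that Theta x + y is in A
    and y is in B can be computed in two ways by Fubini's theorem and
    invariance under translations; this gives
    lambda (Theta^-1 A) lambda (B) = lambda (A) lambda (B)
    ([lebesgue_tuple_orthogonal]). *)

Set Implicit Arguments.
Unset Strict Implicit.
Unset Printing Implicit Defensive.

Import Order.TTheory GRing.Theory Num.Theory.
Import numFieldNormedType.Exports.
Import HBSimple.

Local Open Scope classical_set_scope.
Local Open Scope ring_scope.

(** * Integrals of bounded functions *)

Section bounded_integrals.
Context d (T : measurableType d) (R : realType).
Variable mu : {finite_measure set T -> \bar R}.

Lemma bounded_integrable (f : T -> R) (C : R) : measurable_fun setT f ->
  (forall x, `|f x| <= C) -> mu.-integrable setT (EFin \o f).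
Proof.
move=> mf fC; apply: measurable_bounded_integrable => //.
  by rewrite -ge0_fin_numE ?measure_ge0// fin_num_measure.
exists C; split; first exact: num_real.
by move=> M CM x _; apply: le_trans (fC x) (ltW CM).
Qed.

Lemma cvg_Rintegral_bounded (g : (T -> R)^nat) (f : T -> R) (C : R) :
  (forall n, measurable_fun setT (g n)) -> measurable_fun setT f ->
  (forall n x, `|g n x| <= C) -> (forall x, g n x @[n --> \oo] --> f x) ->
  (\int[mu]_x g n x) @[n --> \oo] --> (\int[mu]_x f x).
Proof.
move=> mg mf gC gf.
have ig : mu.-integrable setT (EFin \o cst C).
  exact: (@bounded_integrable (cst C) `|C|).
have fC x : `|f x| <= C.
  have h : `|g n x| @[n --> \oo] --> `|f x| by apply: cvg_norm; exact: gf.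
  by rewrite -(cvg_lim _ h)//; apply: limr_le; [exact: cvgP h|apply: nearW => n].
have intf := bounded_integrable mf fC.
have [||||_ _] := @dominated_convergence _ _ _ mu setT measurableT
    (fun n => EFin \o g n) (EFin \o f) (EFin \o cst C) _ _ _ ig.
- by move=> n; exact/measurable_EFinP.
- exact/measurable_EFinP.
- by apply: aeW => x _; apply: cvg_EFin; [exact: nearW|exact: gf].
- by apply: aeW => x n _; rewrite lee_fin.
move=> h; apply: fine_cvg; rewrite fineK//.
exact: integrable_fin_num.
Qed.

End bounded_integrals.

(** * Polynomial approximation of an indicator *)

Section polynomial_indicator.
Variable R : realType.
Implicit Types u x y : R.

Lemma bernoulli_ineq x n : -1 <= x -> 1 + n%:R * x <= (1 + x) ^+ n.
Proof.
move=> x1; elim: n => [|n IHn]; first by rewrite mul0r addr0 expr0.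
rewrite exprS -natr1; have n0 : (0 : R) <= n%:R by rewrite ler0n.
have x10 : 0 <= 1 + x by lra.
apply: le_trans (ler_wpM2l x10 IHn).
have : 0 <= n%:R * x ^+ 2 by rewrite mulr_ge0// sqr_ge0.
rewrite expr2; nra.
Qed.

Lemma cvg_natr_mul_expr x : 0 <= x < 1 -> (n%:R * x ^+ n) @[n --> \oo] --> (0 : R).
Proof.
move=> /andP[x0 x1]; have [->|xN0] := eqVneq x 0.
  apply/cvgrPdist_le => e e0; near=> n.
  rewrite expr0n; have -> : (n == 0)%N = false.
    by apply/negbTE; rewrite -lt0n; near: n; exact: nbhs_infty_gt.
  by rewrite mulr0 subr0 normr0 ltW.
have xgt0 : 0 < x by rewrite lt_neqAle eq_sym xN0.
(* n x^n = (n y^n) y^n with y^2 = x, where n y^n is bounded by Bernoulli's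
   inequality and y^n tends to 0 *)
pose y := Num.sqrt x.
have y0 : 0 < y by rewrite sqrtr_gt0.
have yy : y * y = x by rewrite -expr2 sqr_sqrtr.
have y1 : y < 1 by nra.
pose h := y^-1 - 1.
have h0 : 0 < h by rewrite subr_gt0 invf_gt1.
have ny n : n%:R * y ^+ n <= h^-1.
  have B : 1 + n%:R * h <= y^-1 ^+ n.
    have -> : y^-1 = 1 + h by rewrite /h addrC subrK.
    by apply: bernoulli_ineq; lra.
  rewrite -ler_pdivlMr ?exprn_gt0// -exprVn.
  rewrite -(ler_pM2r h0) mulrAC mulVf ?gt_eqF// mul1r; lra.
apply: (@squeeze_cvgr _ _ _ _ (fun=> 0) (fun n => h^-1 * y ^+ n)).
- apply: nearW => n; rewrite mulr_ge0 ?exprn_ge0//=.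
  by rewrite -yy exprMn mulrA ler_wpM2r ?exprn_ge0// ltW.
- exact: cvg_cst.
- rewrite -[X in _ --> X](mulr0 h^-1); apply: cvgMr; apply: cvg_expr.
  by rewrite ger0_norm// ltW.
Unshelve. all: by end_near. Qed.

(** Polynomial approximation of the indicator of [0, 1/2), as in the proof of the
    Stone-Weierstrass theorem: with N = n 2^n, Bernoulli's inequality bounds
    the N-th power below by 1 - n (2u)^n, which tends to 1 if 2u < 1, and above
    by 1 / (1 + n (2u)^n), which tends to 0 if 2u >= 1.  The factor n is what
    makes the limit at u = 1/2 equal to 0. *)
Lemma cvg_stone u : 0 <= u <= 1 ->
  (1 - u ^+ n) ^+ (n * 2 ^ n)%N @[n --> \oo] --> ((u < 2^-1)%R%:R : R).
Proof.
move=> /andP[u0 u1].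
have un n : 0 <= u ^+ n <= 1 by rewrite exprn_ge0//= exprn_ile1.
have NE n : ((n * 2 ^ n)%N%:R : R) * u ^+ n = n%:R * (2 * u) ^+ n.
  by rewrite natrM natrX exprMn mulrA.
have [u2|u2] := ltP.
  apply: (@squeeze_cvgr _ _ _ _ (fun n => 1 - n%:R * (2 * u) ^+ n) (fun=> 1)).
  - apply: nearW => n; have /andP[un0 un1] := un n; apply/andP; split.
      by rewrite -NE -mulrN bernoulli_ineq// lerN2.
    by rewrite exprn_ile1//; lra.
  - rewrite -[X in _ --> X]subr0; apply: cvgB; first exact: cvg_cst.
    by apply: cvg_natr_mul_expr; apply/andP; split; lra.
  - exact: cvg_cst.
apply: (@squeeze_cvgr _ _ _ _ (fun=> 0) harmonic).
- apply: nearW => n; have /andP[un0 un1] := un n; apply/andP; split.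
    by rewrite exprn_ge0// subr_ge0.
  rewrite /= -[leRHS]div1r ler_pdivlMr ?ltr0n//.
  (* with v = u^n, (1 - v)^N (1 + v)^N = (1 - v^2)^N <= 1 *)
  apply: (@le_trans _ _ ((1 - u ^+ n) ^+ (n * 2 ^ n)%N * (1 + u ^+ n) ^+ (n * 2 ^ n)%N)).
    rewrite ler_wpM2l// ?exprn_ge0 ?subr_ge0//.
    apply: le_trans (bernoulli_ineq _ _); last lra.
    rewrite NE -natr1 addrC lerD2l ler_peMr// exprn_ege1//; lra.
  rewrite -exprMn exprn_ile1//; nra.
- exact: cvg_cst.
- exact: cvg_harmonic.
Qed.

End polynomial_indicator.

(** * Uniqueness of characteristic functions on R^n *)

Section linear_form.
Context {R : realType} {n : nat}.

Definition linear_form (theta : 'I_n -> R) (x : n.-tuple R) : R :=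
  \sum_(i < n) theta i * tnth x i.

Lemma measurable_linear_form theta : measurable_fun setT (linear_form theta).
Proof.
apply: measurable_sum => i; apply: measurable_funM => //.
exact: measurable_tnth.
Qed.

Lemma linear_formD t1 t2 x :
  linear_form (fun i => t1 i + t2 i) x = linear_form t1 x + linear_form t2 x.
Proof. by rewrite -big_split; apply: eq_bigr => i _; rewrite /= mulrDl. Qed.

Lemma linear_formB t1 t2 x :
  linear_form (fun i => t1 i - t2 i) x = linear_form t1 x - linear_form t2 x.
Proof. by rewrite -sumrB; apply: eq_bigr => i _; rewrite /= mulrBl. Qed.

Lemma linear_form0 x : linear_form (fun=> 0) x = 0.
Proof. by apply: big1 => i _; rewrite mul0r. Qed.

Lemma linear_form_delta i t x :
  linear_form (fun j => t * (j == i)%:R) x = t * tnth x i.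
Proof.
rewrite /linear_form (bigD1 i)//= eqxx mulr1 big1 ?addr0// => j /negPf ->.
by rewrite mulr0 mul0r.
Qed.

End linear_form.

Section uniqueness.
Context (R : realType) (n : nat) (mu nu : probability (n.-tuple R) R).
Implicit Types (f g : n.-tuple R -> R) (theta tau : 'I_n -> R) (c e : R).

Hypothesis same_cos : forall theta c,
  \int[mu]_x cos (linear_form theta x + c) =
  \int[nu]_x cos (linear_form theta x + c).

Definition bounded_mfun f :=
  measurable_fun setT f /\ exists C : R, forall x, `|f x| <= C.

(** The class of functions that two measures with the same characteristic
    function cannot separate, even after multiplication by a plane wave.  The
    wave makes the class stable under products with sines. *)
Definition trig_class f := bounded_mfun f /\ forall theta c,
  \int[mu]_x (cos (linear_form theta x + c) * f x) =
  \int[nu]_x (cos (linear_form theta x + c) * f x).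

Let wave theta c x := cos (linear_form theta x + c).

Let measurable_wave theta c : measurable_fun setT (wave theta c).
Proof.
apply: measurableT_comp; first by apply: continuous_measurable_fun; exact: continuous_cos.
apply: measurable_funD; last exact: measurable_cst.
exact: measurable_linear_form.
Qed.

Let bounded_waveM theta c f : bounded_mfun f ->
  bounded_mfun (fun x => wave theta c x * f x).
Proof.
move=> [mf [C fC]]; split; first exact: measurable_funM.
by exists C => x; rewrite normrM (le_trans _ (fC x))// ler_piMl ?cos_max.
Qed.

Let integrable_waveM (m : probability (n.-tuple R) R) theta c f : bounded_mfun f ->
  m.-integrable setT (EFin \o (fun x => wave theta c x * f x)).
Proof. by move=> /(bounded_waveM theta c)[mf [C fC]]; exact: bounded_integrable fC. Qed.

Lemma trig_class_lin a f g : trig_class f -> trig_class g ->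
  trig_class (fun x => a * f x + g x).
Proof.
move=> [bf ef] [bg eg]; split.
  have [mf [C fC]] := bf; have [mg [D gD]] := bg; split.
    by apply: measurable_funD => //; exact: measurable_funM.
  exists (`|a| * C + D) => x; rewrite (le_trans (ler_normD _ _))// lerD//.
  by rewrite normrM ler_wpM2l.
move=> theta c.
have E (m : probability (n.-tuple R) R) :
    \int[m]_x (wave theta c x * (a * f x + g x)) =
    a * \int[m]_x (wave theta c x * f x) + \int[m]_x (wave theta c x * g x).
  rewrite -RintegralZl//; last exact: integrable_waveM.
  rewrite -RintegralD//; first by apply: eq_Rintegral => x _; rewrite mulrDr mulrCA.
    rewrite (_ : EFin \o _ = EFin \o (fun x => wave theta c x * (a * f x))).
      apply: integrable_waveM; have [mf [C fC]] := bf; split.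
        exact: measurable_funM.
      by exists (`|a| * C) => x; rewrite normrM ler_wpM2l.
    by apply/funext => x /=; rewrite mulrCA.
  exact: integrable_waveM.
by rewrite -/(wave theta c) !E ef eg.
Qed.

Lemma trig_class_lim (g : (n.-tuple R -> R)^nat) f (C : R) :
  (forall k, trig_class (g k)) -> (forall k x, `|g k x| <= C) ->
  (forall x, g k x @[k --> \oo] --> f x) -> measurable_fun setT f ->
  trig_class f.
Proof.
move=> Vg gC gf mf.
have fC x : `|f x| <= C.
  have h : `|g k x| @[k --> \oo] --> `|f x| by apply: cvg_norm; exact: gf.
  by rewrite -(cvg_lim _ h)//; apply: limr_le; [exact: cvgP h|apply: nearW => k].
split; first by split => //; exists C.
move=> theta c.
have E (m : probability (n.-tuple R) R) :
    (\int[m]_x (wave theta c x * g k x)) @[k --> \oo] -->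
    (\int[m]_x (wave theta c x * f x)).
  apply: (@cvg_Rintegral_bounded _ _ _ _ _ _ C).
  - by move=> k; have [[mg _] _] := Vg k; exact: measurable_funM.
  - exact: measurable_funM.
  - by move=> k x; rewrite normrM (le_trans _ (gC k x))// ler_piMl ?cos_max.
  - by move=> x; apply: cvgMr; exact: gf.
have <- := cvg_lim (@Rhausdorff R) (E mu).
have <- := cvg_lim (@Rhausdorff R) (E nu).
by congr (limn _); apply/funext => k; exact: (Vg k).2.
Qed.

Lemma trig_class1 : trig_class (fun=> 1).
Proof.
split; first by split => //; exists 1 => x; rewrite normr1.
by move=> theta c; under eq_Rintegral do rewrite mulr1;
  under [RHS]eq_Rintegral do rewrite mulr1.
Qed.

Lemma trig_class_sin f tau e : trig_class f ->
  trig_class (fun x => f x * sin (linear_form tau x + e)).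
Proof.
move=> [bf ef].
have sinE x : sin (linear_form tau x + e) = wave tau (e - pi / 2) x.
  by rewrite /wave addrA cosBpihalf.
split.
  have [mf [C fC]] := bounded_waveM tau (e - pi / 2) bf.
  split; last by exists C => x; rewrite sinE mulrC.
  rewrite (_ : (fun x => _) = (fun x => wave tau (e - pi / 2) x * f x))//.
  by apply/funext => x; rewrite sinE mulrC.
move=> theta c.
(* cos A sin B is half the difference of the cosines of A + B - pi/2 and
   A - B - pi/2, whose phases are again affine in x *)
pose w1 := wave (fun i => theta i + tau i) (c + e - pi / 2).
pose w2 := wave (fun i => theta i - tau i) (c - e - pi / 2).
have E (m : probability (n.-tuple R) R) :
    \int[m]_x (wave theta c x * (f x * sin (linear_form tau x + e))) =
    2^-1 * (\int[m]_x (w1 x * f x) - \int[m]_x (w2 x * f x)).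
  rewrite -RintegralB//; [|exact: integrable_waveM..].
  rewrite -RintegralZl//; last first.
    rewrite (_ : EFin \o _ = (fun x => (w1 x * f x)%:E - (w2 x * f x)%:E)%E)//.
    by apply: integrableB => //; exact: integrable_waveM.
  apply: eq_Rintegral => x _.
  rewrite /w1 /w2 /wave linear_formD linear_formB !addrA !cosBpihalf.
  set A := linear_form theta x; set B := linear_form tau x.
  rewrite (_ : A + B + c + e = (A + c) + (B + e)); last by ring.
  rewrite (_ : A - B + c - e = (A + c) - (B + e)); last by ring.
  by rewrite [in RHS]sinD sinB; lra.
by rewrite -/(wave theta c) !E !ef.
Qed.

Lemma trig_class_horner f tau e (p : {poly R}) : trig_class f ->
  trig_class (fun x => f x * p.[sin (linear_form tau x + e)]).
Proof.
move=> Vf; elim/poly_ind: p => [|p a IHp].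
  have /(trig_class_lin (-1) Vf) : trig_class f by [].
  congr trig_class; apply/funext => x; rewrite horner0; ring.
have := trig_class_lin a Vf (trig_class_sin tau e IHp).
by congr trig_class; apply/funext => x; rewrite !hornerE; ring.
Qed.

(** The polynomials of [cvg_stone] in u = (1 + sin) / 2, which lies in [0, 1] and
    is below 1/2 exactly when the sine is negative, converge boundedly to the
    indicator. *)
Lemma trig_class_sin_lt0 f tau e : trig_class f ->
  trig_class (fun x => f x * (sin (linear_form tau x + e) < 0)%R%:R).
Proof.
move=> Vf; have [[mf [C fC]] _] := Vf.
pose s x := sin (linear_form tau x + e).
pose u x := (1 + s x) / 2.
pose p k : {poly R} := (1 - (2^-1 *: (1 + 'X)) ^+ k) ^+ (k * 2 ^ k)%N.
have pE k x : (p k).[s x] = (1 - u x ^+ k) ^+ (k * 2 ^ k)%N.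
  by rewrite /p !(hornerE, horner_exp) mulrC.
have u01 x : 0 <= u x <= 1.
  by have := sin_geN1 (linear_form tau x + e); have := sin_le1 (linear_form tau x + e);
     rewrite -/(s x) /u => *; apply/andP; split; lra.
have ms : measurable_fun setT s.
  apply: measurableT_comp; first by apply: continuous_measurable_fun; exact: continuous_sin.
  apply: measurable_funD; last exact: measurable_cst.
  exact: measurable_linear_form.
apply: (@trig_class_lim (fun k x => f x * (p k).[s x]) _ C).
- by move=> k; exact: trig_class_horner.
- move=> k x; rewrite normrM (le_trans _ (fC x))// ler_piMr// pE.
  have /andP[u0 u1] := u01 x; have /andP[v0 v1] : 0 <= u x ^+ k <= 1.
    by rewrite exprn_ge0//= exprn_ile1.
  by rewrite ger0_norm ?exprn_ge0 ?exprn_ile1//; lra.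
- move=> x; apply: cvgMr; under eq_fun do rewrite pE.
  have -> : (sin (linear_form tau x + e) < 0) = (u x < 2^-1).
    by rewrite -/(s x) /u; apply/idP/idP => ?; lra.
  exact: cvg_stone.
- apply: measurable_funM => //.
  rewrite (_ : (fun x => _) = \1_[set x | s x < 0]); last first.
    by apply/funext => x; rewrite indicE; congr ((nat_of_bool _)%:R); apply/idP/idP; rewrite inE.
  apply: measurable_indic; rewrite -[X in measurable X]setTI.
  rewrite (_ : [set x | s x < 0] = s @^-1` `]-oo, 0[%classic); last first.
    by apply/seteqP; split => x /=; rewrite in_itv.
  exact: ms.
Qed.

Lemma measurable_tnth_lt i a : measurable [set x : n.-tuple R | tnth x i < a].
Proof.
rewrite (_ : [set x | _] = (fun x => tnth x i) @^-1` `]-oo, a[%classic); last first.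
  by apply/seteqP; split => x /=; rewrite in_itv.
by rewrite -[X in measurable X]setTI; apply: measurable_tnth.
Qed.

(** The sign of sin (t (x_i - a)) is that of x_i - a once t > 0 is small: let t
    tend to 0. *)
Lemma trig_class_ray f i a : trig_class f ->
  trig_class (fun x => f x * \1_[set x : n.-tuple R | tnth x i < a] x).
Proof.
move=> Vf; have [[mf [C fC]] _] := Vf.
pose t k : R := k.+1%:R^-1.
pose g k x := f x * (sin (linear_form (fun j => t k * (j == i)%:R) x - t k * a) < 0)%R%:R.
apply: (@trig_class_lim g _ C).
- by move=> k; exact: trig_class_sin_lt0.
- move=> k x; rewrite normrM (le_trans _ (fC x))// ler_piMr//.
  by case: (_ < _); rewrite ?normr0 ?normr1.
- move=> x; apply: cvgMr.
  apply: cvg_near_cst; near=> k.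
  rewrite linear_form_delta -mulrBr indicE; congr ((nat_of_bool _)%:R : R).
  set y := tnth x i - a.
  have t0 : 0 < t k by rewrite invr_gt0.
  have ty : `|t k * y| < pi.
    rewrite normrM gtr0_norm// mulrC ltr_pdivrMr//.
    apply: (@lt_le_trans _ _ (1 * k.+1%:R)); last first.
      by rewrite ler_wpM2r// (le_trans _ (pi_ge2 R))// ler1n.
    rewrite mul1r -natr1 ltr_pwDr//.
    by near: k; exact: nbhs_infty_ger.
  have -> : (x \in [set x : n.-tuple R | tnth x i < a]) = (y < 0).
    by rewrite subr_lt0; apply/idP/idP; rewrite inE.
  have [y0|y0|y0] := ltgtP y 0.
  + rewrite -oppr_gt0 -sinN sin_gt0_pi// -mulrN mulr_gt0 ?oppr_gt0//=.
    by rewrite mulrN; apply: le_lt_trans ty; rewrite -normrN ler_norm.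
  + apply/negbTE; rewrite -leNgt sin_ge0_pi// mulr_ge0 ?ltW//=.
    by apply: le_lt_trans ty; exact: ler_norm.
  + by rewrite y0 mulr0 sin0 ltxx.
- apply: measurable_funM => //; apply: measurable_indic.
  exact: measurable_tnth_lt.
Unshelve. all: by end_near. Qed.

Definition trig_sets : set (set (n.-tuple R)) :=
  [set B | measurable B /\ forall f, trig_class f -> trig_class (fun x => f x * \1_B x)].

(** Since membership asks for stability of the whole class, these sets are closed
    under finite intersections, and pointwise limits give countable unions. *)
Lemma sigma_algebra_trig_sets : sigma_algebra setT trig_sets.
Proof.
have VC B : trig_sets B -> trig_sets (~` B).
  move=> [mB VB]; split; first exact: measurableC.
  move=> f Vf; have := trig_class_lin (-1) (VB _ Vf) Vf.
  congr trig_class; apply/funext => x.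
  by rewrite !indicE in_setC; case: (x \in B) => /=; ring.
split.
- split=> // f Vf; have := trig_class_lin (-1) Vf Vf.
  by congr trig_class; apply/funext => x; rewrite indic0 /=; ring.
- by move=> A VA; rewrite setTD; exact: VC.
- move=> A VA; rewrite -[\bigcup_i A i]setCK; apply/VC.
  have mC : measurable (~` \bigcup_k A k).
    by apply/measurableC/bigcup_measurable => k _; exact: (VA k).1.
  split=> // f Vf; have [[mf [C fC]] _] := Vf.
  (* the complement of the union is the decreasing limit of the complements of
     the finite unions *)
  pose g k x := f x * \prod_(j < k) \1_(~` A j) x.
  have P01 k x : \prod_(j < k) \1_(~` A j) x =
      (x \in ~` \big[setU/set0]_(j < k) A j)%:R :> R.
    elim: k => [|k IHk]; first by rewrite !big_ord0 setC0 in_setT.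
    rewrite !big_ord_recr/= IHk setCU in_setI indicE.
    by do 2 case: (_ \in _); rewrite /= ?mulr1 ?mulr0.
  apply: (@trig_class_lim g _ C).
  + elim=> [|k IHk].
      by move: Vf; congr trig_class; apply/funext => x; rewrite /g big_ord0 mulr1.
    have := (VC _ (VA k)).2 _ IHk.
    by congr trig_class; apply/funext => x; rewrite /g big_ord_recr/= mulrA.
  + move=> k x; rewrite normrM (le_trans _ (fC x))// ler_piMr// P01.
    by case: (_ \in _); rewrite ?normr0 ?normr1.
  + move=> x; apply: cvgMr; apply: cvg_near_cst.
    have [xA|xA] := pselect ((~` \bigcup_k A k) x).
      near=> k; rewrite P01 indicE (mem_set xA) mem_set//.
      by rewrite -bigcup_mkord => -[j _ Aj]; apply: xA; exists j.
    have [j _ Aj] : (\bigcup_k A k) x by exact: contrapT.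
    near=> k; rewrite P01 indicE (memNset xA) memNset//; apply.
    rewrite -bigcup_mkord; exists j => //=.
    by near: k; exact: nbhs_infty_gt.
  + by apply: measurable_funM => //; exact: measurable_indic.
Unshelve. all: by end_near. Qed.

Lemma measurable_trig_sets : measurable `<=` trig_sets.
Proof.
have sa := sigma_algebra_trig_sets.
have cyl i (B : set R) : measurable B -> trig_sets ((fun x => tnth x i) @^-1` B).
  pose S : set (set R) := [set B | trig_sets ((fun x => tnth x i) @^-1` B)].
  have saS : sigma_algebra setT S.
    have [s0 sC sU] := sa; split; rewrite /S/=.
    - by rewrite preimage_set0.
    - by move=> A; rewrite !setTD preimage_setC -setTD; exact: sC.
    - by move=> A VA; rewrite preimage_bigcup; exact: sU.
  suff : measurable `<=` S by apply.
  rewrite (_ : measurable = (@RGenInftyO.G R).-sigma.-measurable :> set (set R)).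
    apply: smallest_sub => // _ [a ->]; rewrite /S/=.
    rewrite (_ : _ @^-1` _ = [set x : n.-tuple R | tnth x i < a]).
      split; first exact: measurable_tnth_lt.
      by move=> f; exact: trig_class_ray.
    by apply/seteqP; split => x /=; rewrite in_itv.
  exact: RGenInftyO.measurableE.
apply: smallest_sub => //.
elim/big_ind: _ => //; first by move=> A B; rewrite subUset.
by move=> i _ _ [B mB <-]; rewrite setTI; exact: cyl.
Qed.

(** The class contains the indicator of B; take theta = 0 and c = 0. *)
Lemma eq_measure_of_cos (B : set (n.-tuple R)) : measurable B -> mu B = nu B.
Proof.
move=> /measurable_trig_sets[mB /(_ _ trig_class1)[_ /(_ (fun=> 0) 0)]].
have E (m : probability (n.-tuple R) R) :
    \int[m]_x (cos (linear_form (fun=> 0) x + 0) * (1 * \1_B x)) = fine (m B).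
  rewrite /Rintegral -[in RHS](setIT B) -integral_indic//; congr fine.
  by apply: eq_integral => x _; rewrite linear_form0 addr0 cos0 !mul1r.
rewrite !E => mn; rewrite -[LHS]fineK ?fin_num_measure//.
by rewrite mn fineK// fin_num_measure.
Qed.

End uniqueness.

(** * Lebesgue measure under affine maps *)

Section affine_maps.
Context {R : realType}.
Local Open Scope ereal_scope.

Lemma lebesgue_measure_affine (a b : R) (A : set (measurableTypeR R)) :
  (0 < a)%R -> measurable A ->
  lebesgue_measure A = a%:E * lebesgue_measure ((fun x : R => a * x + b)%R @^-1` A).
Proof.
move=> a0 mA; have a0' : (0 <= a)%R by exact: ltW.
pose f : measurableTypeR R -> measurableTypeR R := fun x : R => (a * x + b)%R.
have mf : measurable_fun setT f.
  by apply: measurable_funD; [exact: measurable_funM|exact: measurable_cst].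
pose p := measure_function_pushforward__canonical__measure_function_Measure
  (@lebesgue_measure R) mf.
rewrite (@lebesgue_measure_unique _ (mscale (NngNum a0') p))// => _ [[u v] _ <-].
rewrite [RHS](_ : _ = a%:E * lebesgue_measure (f @^-1` `]u, v]%classic))//.
rewrite [X in _ * lebesgue_measure X](_ : _ =
  `]((u - b) / a)%R, ((v - b) / a)%R]%classic); last first.
  apply/seteqP; split => x /=; rewrite !in_itv/= ltr_pdivrMr// ler_pdivlMr// (mulrC x);
    by rewrite ltrBlDr lerBrDr.
rewrite !lebesgue_measure_itv/= !lte_fin ltr_pM2r ?invr_gt0// ltrD2r.
case: ifPn => uv; last by rewrite mule0.
by rewrite -!EFinB -EFinM -mulrBl mulrCA divff ?gt_eqF// mulr1; congr _%:E; ring.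
Qed.

Definition affine_map {d} (a : R) (s x : d.-tuple R) : d.-tuple R :=
  [tuple (a * tnth x i + tnth s i)%R | i < d].

Lemma measurable_affine_map d a s : measurable_fun setT (@affine_map d a s).
Proof.
apply/measurable_fun_tnthP => i.
apply: (eq_measurable_fun (fun x : d.-tuple R => (a * tnth x i + tnth s i)%R)).
  by move=> x _; rewrite /= tnth_mktuple.
by apply: measurable_funD => //; apply: measurable_funM => //; exact: measurable_tnth.
Qed.

(** By induction on d, the image measure of a product of affine maps agrees with
    the product measure on rectangles. *)
Lemma lebesgue_tuple_affine d (a : R) (s : d.-tuple R) (A : set (d.-tuple R)) :
  (0 < a)%R -> measurable A ->
  lebesgue_tuple R d A =
  (a ^+ d)%:E * lebesgue_tuple R d (affine_map a s @^-1` A).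
Proof.
move=> a0; elim: d s A => [|d IHd] s A mA.
  rewrite expr0 mul1e; congr (lebesgue_tuple R 0 _); apply/seteqP; split => x /=;
    by rewrite [affine_map _ _ _]tuple0 [x]tuple0.
have ad0 : (0 <= a ^+ d.+1)%R by rewrite exprn_ge0 ?ltW.
pose s0 := thead s; pose s1 : d.-tuple R := [tuple of behead s].
pose f (p : measurableTypeR R * d.-tuple R) : measurableTypeR R * d.-tuple R :=
  ((a * p.1 + s0)%R : measurableTypeR R, affine_map a s1 p.2).
have mf : measurable_fun setT f.
  apply: measurable_fun_pair.
    apply: measurable_funD; last exact: measurable_cst.
    apply: measurable_funM; first exact: measurable_cst.
    exact: (@measurable_fst _ _ (measurableTypeR R) (d.-tuple R)).
  apply: measurableT_comp; first exact: measurable_affine_map.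
  exact: measurable_snd.
pose p := measure_function_pushforward__canonical__measure_function_Measure
  (@lebesgue_measure R \x lebesgue_tuple R d) mf.
rewrite /= /cons_measure /pushforward.
rewrite (@product_measure_unique _ _ _ _ _ _ _ (mscale (NngNum ad0) p)); last 2 first.
- move=> X Y mX mY.
  rewrite [LHS](_ : _ = (a ^+ d.+1)%:E *
    (lebesgue_measure \x lebesgue_tuple R d) (f @^-1` (X `*` Y)))//.
  have -> : f @^-1` (X `*` Y) =
      ((fun x : R => a * x + s0)%R @^-1` X) `*` (affine_map a s1 @^-1` Y) by [].
  rewrite product_measure1E.
  + rewrite exprS EFinM muleACA; apply/esym.
    exact: (f_equal2 mule (lebesgue_measure_affine s0 a0 mX) (IHd s1 Y mY)).
  + rewrite -[X in measurable X]setTI.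
    by apply: measurable_funD; [exact: measurable_funM|exact: measurable_cst|..].
  + by rewrite -[X in measurable X]setTI; exact: measurable_affine_map.
- by rewrite -[X in measurable X]setTI; exact: measurable_tuple_cons.
rewrite [LHS](_ : _ = (a ^+ d.+1)%:E * (lebesgue_measure \x lebesgue_tuple R d)
  (f @^-1` (@tuple_cons R d @^-1` A)))//.
suff -> : f @^-1` (@tuple_cons R d @^-1` A) =
    @tuple_cons R d @^-1` (affine_map a s @^-1` A) by [].
suff e p' : tuple_cons (f p') = affine_map a s (tuple_cons p').
  by apply/seteqP; split => p' /=; rewrite e.
case: p' => x t; apply/eq_from_tnth => i; rewrite tnth_mktuple.
case: (unliftP ord0 i) => [j ->|->].
  rewrite !tnthS tnth_mktuple tnth_behead; congr (_ + tnth s _)%R.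
  by apply: val_inj; rewrite /= inordK// ltnS.
by rewrite /f /s0 /thead !(tnth_nth 0%R).
Qed.

End affine_maps.

(** * Lebesgue measure under orthogonal maps *)

Section orthogonal_maps.
Context {R : realType} {d : nat}.
Local Notation E := (d.-tuple R).
Local Notation lambda := (lebesgue_tuple R d).
Implicit Types (x y s : E) (A B : 'M[R]_d).

Lemma mx_mapM A B x : mx_map A (mx_map B x) = mx_map (A *m B) x.
Proof.
apply/eq_from_tnth => i; rewrite !tnth_mktuple.
under eq_bigr do rewrite tnth_mktuple mulr_sumr.
under [RHS]eq_bigr do rewrite mxE mulr_suml.
rewrite exchange_big/=; apply: eq_bigr => j _; apply: eq_bigr => k _.
by rewrite mulrA.
Qed.

Lemma mx_map1 x : mx_map 1%:M x = x.
Proof.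
apply/eq_from_tnth => i; rewrite tnth_mktuple (bigD1 i)//= mxE eqxx mul1r.
by rewrite big1 ?addr0// => j /negPf ji; rewrite mxE eq_sym ji mul0r.
Qed.

Lemma mx_map_translation A s x :
  mx_map A (translation s x) = translation (mx_map A s) (mx_map A x).
Proof.
apply/eq_from_tnth => i; rewrite !tnth_mktuple -big_split; apply: eq_bigr => j _.
by rewrite !tnth_mktuple mulrDr.
Qed.

Lemma orthogonal_groupC A : orthogonal_group A -> A *m A^T = 1%:M.
Proof. exact: mulmx1C. Qed.

Lemma orthogonalK A : orthogonal_group A -> cancel (mx_map A) (mx_map A^T).
Proof. by move=> AA x; rewrite mx_mapM AA mx_map1. Qed.

Lemma orthogonalVK A : orthogonal_group A -> cancel (mx_map A^T) (mx_map A).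
Proof. by move=> AA x; rewrite mx_mapM orthogonal_groupC// mx_map1. Qed.

Lemma euclidean_norm_orthogonal A x : orthogonal_group A ->
  euclidean_norm (mx_map A x) = euclidean_norm x.
Proof.
move=> AA; congr Num.sqrt.
under eq_bigr do rewrite tnth_mktuple expr2 mulr_suml.
under eq_bigr do under eq_bigr do rewrite mulr_sumr.
rewrite exchange_big/=; apply: eq_bigr => j _; rewrite exchange_big/=.
transitivity (\sum_k tnth x j * tnth x k * (A^T *m A) j k).
  apply: eq_bigr => k _; rewrite mxE mulr_sumr; apply: eq_bigr => i _.
  by rewrite mxE; ring.
rewrite AA (bigD1 j)//= mxE eqxx mulr1 big1 ?addr0 ?expr2// => k /negPf kj.
by rewrite mxE eq_sym kj mulr0.
Qed.

Lemma euclidean_normN x : euclidean_norm (dilation (-1) x) = euclidean_norm x.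
Proof. by congr Num.sqrt; apply: eq_bigr => i _; rewrite tnth_mktuple mulN1r sqrrN. Qed.

Lemma euclidean_norm_le1 x : (euclidean_norm x <= 1) = (\sum_(i < d) tnth x i ^+ 2 <= 1).
Proof. by rewrite /euclidean_norm -{1}(@sqrtr1 R) ler_sqrt. Qed.

Lemma measurable_unit_ball : measurable (@unit_ball R d).
Proof.
rewrite (_ : unit_ball = (fun x : E => \sum_(i < d) tnth x i ^+ 2) @^-1` `]-oo, 1%R]%classic).
  have mf : measurable_fun setT (fun x : E => \sum_(i < d) tnth x i ^+ 2).
    by apply: measurable_sum => i; apply: measurable_funX; exact: measurable_tnth.
  by rewrite -[X in measurable X]setTI; exact: mf.
by apply/seteqP; split => x; rewrite /unit_ball /= in_itv/= euclidean_norm_le1.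
Qed.

Let box (r : R) : set E := [set x | forall i, `[- r, r]%classic (tnth x i)].

Let measurable_box r : measurable (box r).
Proof.
rewrite (_ : box r = \bigcap_(i in [set: 'I_d]) ((@tnth _ R ^~ i) @^-1` `[- r, r]%classic)).
  apply: fin_bigcap_measurable => // i _; rewrite -[X in measurable X]setTI.
  exact: measurable_tnth.
by apply/seteqP; split => x /= h i => [_|]; exact: h.
Qed.

Let lebesgue_box r : 0 < r -> lambda (box r) = ((r *+ 2) ^+ d)%:E.
Proof.
move=> r0; rewrite (@lebesgue_tuple_box _ _ (fun=> `[- r, r]%classic))//.
under eq_bigr do rewrite lebesgue_measure_itv/= lte_fin gtrN// -EFinB opprK.
by rewrite prodEFin prodr_const card_ord.
Qed.

Lemma lebesgue_unit_ball_gt0 : (0 < lambda (@unit_ball R d))%E.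
Proof.
(* the cube of half-side 1 / (d + 1) is inside the ball, also for d = 0 *)
pose r : R := d.+1%:R^-1.
have r0 : 0 < r by rewrite invr_gt0.
apply: (@lt_le_trans _ _ (lambda (box r))).
  by rewrite lebesgue_box// lte_fin exprn_gt0// mulrn_wgt0.
apply: le_measure; rewrite ?inE//; first exact: measurable_unit_ball.
move=> x /= xr; rewrite /unit_ball /= euclidean_norm_le1.
apply: (@le_trans _ _ (\sum_(i < d) r ^+ 2)).
  apply: ler_sum => i _; have := xr i; rewrite /= in_itv/= -ler_norml => xi.
  by rewrite -[leLHS]real_normK ?num_real// lerXn2r// nnegrE// ltW.
rewrite sumr_const card_ord -[leLHS]mulr_natr expr2 -mulrA.
have rd : r * d%:R <= 1 by rewrite mulrC ler_pdivrMr// mul1r ler_nat.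
have r1 : r <= 1 by rewrite invf_le1// ler1n.
by rewrite mulr_ile1// ?mulr_ge0// ltW.
Qed.

Lemma lebesgue_unit_ball_lty : (lambda (@unit_ball R d) < +oo)%E.
Proof.
apply: (@le_lt_trans _ _ (lambda (box 1))); last by rewrite lebesgue_box// ltry.
apply: le_measure; rewrite ?inE//; first exact: measurable_unit_ball.
move=> x; rewrite /unit_ball /= euclidean_norm_le1 => x1 i.
rewrite /= in_itv/= -ler_norml -(@ler_pXn2r _ 2)// ?nnegrE// real_normK ?num_real//.
rewrite expr1n (le_trans _ x1)// (bigD1 i)//= lerDl sumr_ge0// => j _.
by rewrite sqr_ge0.
Qed.

Lemma lebesgue_tuple_translation s (A : set E) : measurable A ->
  lambda (translation s @^-1` A) = lambda A.
Proof.
move=> mA; rewrite (lebesgue_tuple_affine s ltr01 mA) expr1n mul1e.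
congr (lambda (_ @^-1` A)); apply/funext => x; apply/eq_from_tnth => i.
by rewrite !tnth_mktuple mul1r.
Qed.

(** Let S1 be the set of the (x, y) with Theta x + y in A and y in B.  For fixed y in
    B its section is a translate of Theta^-1 A, so that S1 has mass
    lambda (Theta^-1 A) lambda (B).  Replacing y by z = Theta x + y, a translation
    for fixed x, turns S1 into the set S2 of the (x, z) with z in A and
    z - Theta x in B.  As the ball B is symmetric and Theta-invariant, for fixed z
    in A the section of S2 is the translate of B by Theta^T z, so that S2 has mass
    lambda (A) lambda (B).  Finally 0 < lambda (B) < oo. *)
Lemma lebesgue_tuple_orthogonal (Theta : 'M[R]_d) (A : set E) :
  orthogonal_group Theta -> measurable A ->
  lambda (mx_map Theta @^-1` A) = lambda A.
Proof.
move=> Th mA; pose B := @unit_ball R d; have mB := measurable_unit_ball.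
pose S1 : set (E * E) := [set p | A (translation p.2 (mx_map Theta p.1)) /\ B p.2].
pose S2 : set (E * E) :=
  [set p | A p.2 /\ B (translation (dilation (-1) (mx_map Theta p.1)) p.2)].
have mth : measurable_fun setT (fun p : E * E => mx_map Theta p.1).
  by apply: measurableT_comp; [exact: measurable_mx_map|exact: measurable_fst].
have madd (f g : E * E -> E) : measurable_fun setT f -> measurable_fun setT g ->
    measurable_fun setT (fun p => translation (f p) (g p)).
  move=> mf mg; apply/measurable_fun_tnthP => i.
  apply: (eq_measurable_fun (fun p => tnth (g p) i + tnth (f p) i)).
    by move=> x _; rewrite /= tnth_mktuple.
  by apply: measurable_funD; apply: (@measurableT_comp _ _ _ _ _ _ (fun x : E => tnth x i)) => //;
    exact: measurable_tnth.
have mS1 : measurable S1.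
  rewrite (_ : S1 = (fun p => translation p.2 (mx_map Theta p.1)) @^-1` A `&` snd @^-1` B)//.
  apply: measurableI; rewrite -[X in measurable X]setTI.
    by apply: (madd snd _ measurable_snd mth).
  exact: measurable_snd.
have mS2 : measurable S2.
  rewrite (_ : S2 = snd @^-1` A `&`
    (fun p => translation (dilation (-1) (mx_map Theta p.1)) p.2) @^-1` B)//.
  apply: measurableI; rewrite -[X in measurable X]setTI.
    exact: measurable_snd.
  apply: (madd (fun p => dilation (-1) (mx_map Theta p.1)) snd) => //.
  by apply: measurableT_comp mth; exact: measurable_dilation.
have mThA : measurable (mx_map Theta @^-1` A).
  by rewrite -[X in measurable X]setTI; exact: measurable_mx_map.
have E1 y : lambda (ysection S1 y) = (lambda (mx_map Theta @^-1` A) * (\1_B y)%:E)%E.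
  rewrite indicE; have [yB|yB] := boolP (y \in B).
    rewrite mule1 -(lebesgue_tuple_translation (mx_map Theta^T y) mThA).
    congr (lambda _); apply/seteqP; split => x; rewrite /ysection /= inE /S1 /=.
      by move=> [+ _]; rewrite mx_map_translation orthogonalVK.
    by rewrite mx_map_translation orthogonalVK// => ?; split => //; exact: set_mem.
  rewrite mule0 (_ : ysection S1 y = set0) ?measure0//.
  apply/seteqP; split => x //; rewrite /ysection /= inE => -[_ /= By].
  by move/negP: yB; apply; exact: mem_set.
have E2 x : lambda (xsection S1 x) = lambda (xsection S2 x).
  rewrite -(lebesgue_tuple_translation (mx_map Theta x) (measurable_xsection x mS2)).
  congr (lambda _); apply/seteqP; split => y; rewrite /xsection /= !inE /S1 /S2 /=.
    move=> [Ay By]; split.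
      by congr (A _): Ay; apply/eq_from_tnth => i; rewrite !tnth_mktuple addrC.
    by congr B: By; apply/eq_from_tnth => i; rewrite !tnth_mktuple mulN1r addrK.
  move=> [Ay By]; split.
    by congr (A _): Ay; apply/eq_from_tnth => i; rewrite !tnth_mktuple addrC.
  by congr B: By; apply/eq_from_tnth => i; rewrite !tnth_mktuple mulN1r addrK.
have E3 z : lambda (ysection S2 z) = (lambda B * (\1_A z)%:E)%E.
  rewrite indicE; have [zA|zA] := boolP (z \in A).
    rewrite mule1 -(lebesgue_tuple_translation (dilation (-1) (mx_map Theta^T z)) mB).
    have BE x : B (translation (dilation (-1) (mx_map Theta x)) z) =
                B (translation (dilation (-1) (mx_map Theta^T z)) x).
      rewrite /B /unit_ball /=.
      rewrite -(euclidean_norm_orthogonal (translation (dilation (-1) (mx_map Theta^T z)) x) Th).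
      rewrite -euclidean_normN; congr (euclidean_norm _ <= 1 : Prop).
      have -> : dilation (-1) (mx_map Theta^T z) = mx_map Theta^T (dilation (-1) z).
        apply/eq_from_tnth => i; rewrite !tnth_mktuple mulr_sumr.
        by apply: eq_bigr => j _; rewrite tnth_mktuple mulrCA.
      rewrite mx_map_translation orthogonalVK//.
      by apply/eq_from_tnth => i; rewrite !tnth_mktuple; ring.
    congr (lambda _); apply/seteqP; split => x; rewrite /ysection /= inE /S2 /= BE.
      by case.
    by split => //; exact: set_mem.
  rewrite mule0 (_ : ysection S2 z = set0) ?measure0//.
  apply/seteqP; split => x //; rewrite /ysection /= inE => -[/= Az _].
  by move/negP: zA; apply; exact: mem_set.
have swap (S : set (E * E)) : measurable S ->
    (\int[lambda]_x lambda (xsection S x) = \int[lambda]_y lambda (ysection S y))%E.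
  move=> mS; have := indic_fubini_tonelli lambda lambda mS.
  rewrite (indic_fubini_tonelli_FE lambda mS) => ->; apply: eq_integral => y _.
  by rewrite (indic_fubini_tonelli_GE lambda mS).
have intE (c : \bar R) (C : set E) : (0 <= c)%E -> measurable C ->
    (\int[lambda]_x (c * (\1_C x)%:E) = c * lambda C)%E.
  move=> c0 mC; rewrite ge0_integralZl//; last exact/measurable_EFinP/measurable_indic.
  by rewrite integral_indic// setIT.
have E : (lambda (mx_map Theta @^-1` A) * lambda B = lambda B * lambda A)%E.
  rewrite -intE ?measure_ge0// -(intE (lambda B)) ?measure_ge0//.
  under eq_integral do rewrite -E1; under [RHS]eq_integral do rewrite -E3.
  rewrite -(swap _ mS1) -(swap _ mS2); apply: eq_integral => x _.
  exact: E2.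
have := lebesgue_unit_ball_gt0; have := lebesgue_unit_ball_lty.
rewrite -/B => Blt B0; have Bfin : lambda B \is a fin_num by rewrite ge0_fin_numE ?measure_ge0.
rewrite muleC in E.
apply/eqP; rewrite eq_le -(lee_pmul2l Bfin B0) -[X in _ && X](lee_pmul2l Bfin B0).
by rewrite E lexx.
Qed.

End orthogonal_maps.

(** * Sums of independent random variables *)

Section independent_sums.
Context dO (Omega : measurableType dO) (R : realType) (P : probability Omega R).

(** The real form of E e^(iX) = e^(-a + ip): it is equivalent to it by taking the
    real and imaginary parts of E e^(i (X + c)), and quantifying over c makes
    it stable under sums of independent variables without complex numbers. *)
Definition cos_law (X : Omega -> R) (a p : R) := forall c : R,
  \int[P]_w cos (X w + c) = expR (- a) * cos (p + c).

(** Y plays the role of the partial sum in the induction of [cos_law_sum_from]: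
    unlike the members of the family it may be replaced by Y + X ord0. *)
Definition independent_of_family n (Y : {mfun Omega >-> R})
    (X : 'I_n -> {mfun Omega >-> R}) :=
  forall (B0 : set R) (B : 'I_n -> set R), measurable B0 ->
  (forall i, measurable (B i)) ->
  P (Y @^-1` B0 `&` \bigcap_(i in [set: 'I_n]) X i @^-1` B i) =
  (P (Y @^-1` B0) * \prod_(i < n) P (X i @^-1` B i))%E.

Let pair (Y X : {mfun Omega >-> R}) w := (Y w, X w).

Let measurable_pair (Y X : {mfun Omega >-> R}) : measurable_fun setT (pair Y X).
Proof. exact: measurable_fun_pair. Qed.

(** The event F stands for a condition on further variables; keeping it allows
    independence from them to be passed on to functions of Y and X. *)
Lemma joint_law_product (Y X : {mfun Omega >-> R}) (F : set Omega) :
  measurable F ->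
  (forall A B, measurable A -> measurable B ->
    P (Y @^-1` A `&` X @^-1` B `&` F) = (P (Y @^-1` A) * P (X @^-1` B) * P F)%E) ->
  forall C : set (R * R), measurable C ->
  P (pair Y X @^-1` C `&` F) =
  (P F * (distribution P Y \x distribution P X) C)%E.
Proof.
move=> mF YXF C mC.
have PFfin : P F \is a fin_num by rewrite fin_num_measure.
have [PF0|PF0] := eqVneq (P F) 0%E.
  rewrite PF0 mul0e; apply/eqP; rewrite eq_le measure_ge0 andbT -PF0.
  by apply: le_measure; rewrite ?inE//; apply: measurableI => //;
    rewrite -[X in measurable X]setTI; exact: measurable_pair.
(* conditionally on F, the law of (Y, X) agrees with the product on
   rectangles *)
pose r := fine (P F).
have rE : P F = r%:E by rewrite fineK.
have r0 : r != 0 by apply: contra_neq PF0 => r0; rewrite rE r0.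
have rV0 : 0 <= r^-1 by rewrite invr_ge0 fine_ge0.
pose m := mscale (NngNum rV0)
  (measure_function_pushforward__canonical__measure_function_Measure
    (mrestr P mF) (measurable_pair Y X)).
have mE D : m D = (r^-1%:E * P (pair Y X @^-1` D `&` F))%E by [].
have -> : (distribution P Y \x distribution P X)%E C = m C.
  apply: product_measure_unique => // A B mA mB.
  transitivity (m (A `*` B)) => //; rewrite mE.
  rewrite (_ : pair Y X @^-1` (A `*` B) = Y @^-1` A `&` X @^-1` B)// YXF//.
  by rewrite rE muleCA -EFinM mulVf// mule1.
by rewrite mE rE muleA -EFinM divff// mul1e.
Qed.

(** Fubini: integrating cos (Y + X + c) over X first multiplies by e^-a' and shifts
    the phase by p'. *)
Lemma cos_lawD (Y X : {mfun Omega >-> R}) a p a' p' :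
  (forall A B, measurable A -> measurable B ->
    P (Y @^-1` A `&` X @^-1` B) = (P (Y @^-1` A) * P (X @^-1` B))%E) ->
  cos_law Y a p -> cos_law X a' p' ->
  cos_law (fun w => Y w + X w) (a + a') (p + p').
Proof.
move=> YX Ya Xa c.
have mcos : measurable_fun setT (@cos R).
  by apply: continuous_measurable_fun; exact: continuous_cos.
pose f (z : R * R) := cos (z.1 + z.2 + c).
have mf : measurable_fun setT f.
  apply: measurableT_comp => //; apply: measurable_funD => //.
  by apply: measurable_funD; [exact: measurable_fst|exact: measurable_snd].
have mY : measurable_fun setT Y by exact: measurable_funPT.
have mX : measurable_fun setT X by exact: measurable_funPT.
have intcos (g : Omega -> R) : measurable_fun setT g ->
    P.-integrable setT (EFin \o (fun w => cos (g w))).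
  move=> mg; apply: (@bounded_integrable _ _ _ _ _ 1).
    exact: measurableT_comp.
  by move=> w; exact: cos_max.
have EX (y : R) : (\int[distribution P X]_x (f (y, x))%:E =
    (expR (- a') * cos (p' + (y + c)))%:E)%E.
  rewrite integral_distribution.
  - rewrite -Xa /Rintegral fineK; last first.
      apply: integrable_fin_num => //; apply: intcos.
      by apply: measurable_funD => //.
    by apply: eq_integral => w _ /=; congr (cos _)%:E; rewrite /=; ring.
  - apply/measurable_EFinP.
    rewrite (_ : (fun x => _) = (fun x => cos (y + x + c)))//.
    apply: measurableT_comp => //.
    by apply: measurable_funD => //; apply: measurable_funD.
  - apply: (intcos (fun w => y + X w + c)).
    by apply: measurable_funD => //; apply: measurable_funD.
have intf : (distribution P Y \x distribution P X)%E.-integrable setT (EFin \o f).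
  apply: measurable_bounded_integrable => //.
    rewrite -setXTT/= product_measure1E//.
    by rewrite -ge0_fin_numE ?mule_ge0// fin_numM// fin_num_measure.
  exists 1; split; first exact: num_real.
  by move=> M M1 z _; apply: le_trans (cos_max _) (ltW M1).
have : (\int[P]_w (cos (Y w + X w + c))%:E =
        (expR (- (a + a')) * cos (p + p' + c))%:E)%E.
  transitivity (\int[distribution P Y \x distribution P X]_z (f z)%:E)%E.
    have mpair := measurable_pair Y X.
    rewrite (_ : (fun w => _) = (EFin \o f) \o pair Y X)//.
    rewrite -(@integral_pushforward _ _ _ _ _ _ mpair P setT (EFin \o f))//.
    - apply: eq_measure_integral => C mC _.
      have YXT A B : measurable A -> measurable B ->
          P (Y @^-1` A `&` X @^-1` B `&` setT) =
          (P (Y @^-1` A) * P (X @^-1` B) * P setT)%E.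
        by move=> mA mB; rewrite setIT probability_setT mule1 YX.
      by have := joint_law_product measurableT YXT mC; rewrite probability_setT mul1e setIT.
    - exact/measurable_EFinP.
    - rewrite preimage_setT; apply: (intcos (fun w => Y w + X w + c)).
      by apply: measurable_funD => //; apply: measurable_funD.
  rewrite -integral12_prod_meas1//.
  rewrite /fubini_F; under eq_integral do rewrite EX.
  rewrite integral_distribution/=.
  - have mYc : measurable_fun setT (fun w => Y w + (p' + c)).
      by apply: measurable_funD.
    have icos := intcos _ mYc.
    rewrite (_ : (fun x => _) = (fun w => (expR (- a'))%:E * (cos (Y w + (p' + c)))%:E)%E);
      last first.
      by apply/funext => w; rewrite -EFinM addrCA.
    rewrite integralZl//.
    have /fineK <- := integrable_fin_num measurableT icos.
    rewrite -/(Rintegral P setT (fun w => cos (Y w + (p' + c)))) Ya -EFinM mulrA.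
    by rewrite -expRD addrC -opprD addrA.
  - apply/measurable_EFinP; apply: measurable_funM => //.
    by apply: measurableT_comp => //; apply: measurable_funD => //; apply: measurable_funD.
  - rewrite (_ : _ \o _ = (fun w => (expR (- a'))%:E * (cos (p' + (Y w + c)))%:E)%E)//.
    apply: integrableZl => //; apply: (intcos (fun w => p' + (Y w + c))).
    by apply: measurable_funD => //; apply: measurable_funD.
by rewrite /Rintegral => ->.
Qed.

Lemma cos_law_sum_from n (Y : {mfun Omega >-> R}) (X : 'I_n -> {mfun Omega >-> R})
    (a p : R) (b q : 'I_n -> R) :
  independent_of_family Y X -> cos_law Y a p ->
  (forall i, cos_law (X i) (b i) (q i)) ->
  cos_law (fun w => Y w + \sum_(i < n) X i w)
    (a + \sum_(i < n) b i) (p + \sum_(i < n) q i).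
Proof.
elim: n Y X a p b q => [|n IHn] Y X a p b q YX Ya Xb.
  rewrite !big_ord0 !addr0 => c; rewrite -Ya.
  by apply: eq_Rintegral => w _; rewrite big_ord0 addr0.
have mX i (B : set R) : measurable B -> measurable (X i @^-1` B).
  by move=> mB; rewrite -[X in measurable X]setTI; apply: measurable_funPT.
pose Y' : {mfun Omega >-> R} := (Y + X ord0)%R.
have split_bigcap (B : 'I_n.+1 -> set R) :
    \bigcap_(i in [set: 'I_n.+1]) X i @^-1` B i =
    X ord0 @^-1` B ord0 `&`
    \bigcap_(i in [set: 'I_n]) X (lift ord0 i) @^-1` B (lift ord0 i).
  apply/seteqP; split => w /=.
    by move=> h; split=> [|i _]; exact: h.
  move=> [h0 h] i _; case: (unliftP ord0 i) => [j ->|->//]; exact: h.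
have YX0 A B (C : 'I_n -> set R) : measurable A -> measurable B ->
    (forall i, measurable (C i)) ->
    P (Y @^-1` A `&` X ord0 @^-1` B `&` \bigcap_(i in [set: 'I_n]) X (lift ord0 i) @^-1` C i) =
    (P (Y @^-1` A) * P (X ord0 @^-1` B) * \prod_(i < n) P (X (lift ord0 i) @^-1` C i))%E.
  move=> mA mB mC.
  pose D i := if unlift ord0 i is Some j then C j else B.
  have D0 : D ord0 = B by rewrite /D unlift_none.
  have Dl j : D (lift ord0 j) = C j by rewrite /D liftK.
  have mD i : measurable (D i) by rewrite /D; case: unlift.
  have := YX A D mA mD; rewrite split_bigcap big_ord_recl D0 setIA muleA.
  under eq_bigcapr do rewrite Dl.
  by under eq_bigr do rewrite Dl.
have PT : (\prod_(i < n) P (X (lift ord0 i) @^-1` setT) = 1)%E.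
  by rewrite big1// => i _; rewrite preimage_setT probability_setT.
have IT : \bigcap_(i in [set: 'I_n]) X (lift ord0 i) @^-1` setT = setT.
  by apply/seteqP; split.
have YX02 A B : measurable A -> measurable B ->
    P (Y @^-1` A `&` X ord0 @^-1` B) = (P (Y @^-1` A) * P (X ord0 @^-1` B))%E.
  by move=> mA mB; have := YX0 A B (fun=> setT) mA mB (fun=> measurableT);
    rewrite IT setIT PT mule1.
have F1 (C : 'I_n -> set R) : (forall i, measurable (C i)) ->
    P (\bigcap_(i in [set: 'I_n]) X (lift ord0 i) @^-1` C i) =
    (\prod_(i < n) P (X (lift ord0 i) @^-1` C i))%E.
  move=> mC; have := YX0 setT setT C measurableT measurableT mC.
  by rewrite !preimage_setT !setTI probability_setT !mul1e.
have Y'X : independent_of_family Y' (fun i => X (lift ord0 i)).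
  move=> A C mA mC.
  pose S : set (R * R) := (fun z : R * R => z.1 + z.2) @^-1` A.
  have mS : measurable S.
    rewrite -[X in measurable X]setTI.
    by apply: measurable_funD; [exact: measurable_fst|exact: measurable_snd|..].
  have E : Y' @^-1` A = pair Y (X ord0) @^-1` S by [].
  have mF : measurable (\bigcap_(i in [set: 'I_n]) X (lift ord0 i) @^-1` C i).
    by apply: fin_bigcap_measurable => // i _; exact: mX.
  have T1 A' B' : measurable A' -> measurable B' ->
      P (Y @^-1` A' `&` X ord0 @^-1` B' `&` setT) =
      (P (Y @^-1` A') * P (X ord0 @^-1` B') * P setT)%E.
    by move=> mA' mB'; rewrite setIT probability_setT mule1 YX02.
  have := joint_law_product measurableT T1 mS.
  rewrite setIT probability_setT mul1e E => ->.
  rewrite (joint_law_product mF _ mS); first by rewrite F1// muleC.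
  by move=> A' B' mA' mB'; rewrite YX0// F1.
have := IHn Y' (fun i => X (lift ord0 i)) (a + b ord0) (p + q ord0)
  (fun i => b (lift ord0 i)) (fun i => q (lift ord0 i)) Y'X
  (cos_lawD YX02 Ya (Xb ord0)) (fun i => Xb _).
move=> H c; rewrite !big_ord_recl !addrA -H.
by apply: eq_Rintegral => w _; rewrite big_ord_recl addrA.
Qed.

Lemma cos_law_sum n (X : 'I_n -> {RV P >-> R}) (b q : 'I_n -> R) :
  mutually_independent X -> (forall i, cos_law (X i) (b i) (q i)) ->
  cos_law (fun w => \sum_(i < n) X i w) (\sum_(i < n) b i) (\sum_(i < n) q i).
Proof.
move=> iX Xb.
have H : independent_of_family (cst 0 : {mfun Omega >-> R}) X.
  move=> A B mA mB.
  have [A0|A0] := pselect (A 0).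
    rewrite (_ : cst 0 @^-1` A = setT); last by apply/seteqP; split.
    by rewrite setTI probability_setT mul1e iX.
  rewrite (_ : cst 0 @^-1` A = set0); last by apply/seteqP; split.
  by rewrite set0I measure0 mul0e.
have C0 : cos_law (cst 0 : {mfun Omega >-> R}) 0 0.
  move=> c; rewrite /= add0r oppr0 expR0 mul1r Rintegral_cst//.
  have PT : fine (P [set: Omega]) = 1 := congr1 fine (probability_setT P).
  by rewrite [X in _ * X]PT mulr1.
have := cos_law_sum_from H C0 Xb.
by rewrite !add0r => H' c; rewrite -H'; apply: eq_Rintegral => w _; rewrite /= add0r.
Qed.

End independent_sums.

(** * Stable random measures *)

Section stable_random_measures.
Context dO (Omega : measurableType dO) (R : realType) (P : probability Omega R).
Context d (T : measurableType d).
Variables (gamma b : R) (m : {measure set T -> \bar R}) (M : set T -> {RV P >-> R}).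
Hypothesis M_stable : stable_random_measure gamma b m M.

Local Notation skew := (b * tan (pi * gamma / 2)).

Lemma stable_random_measure_cos_law A (theta : R) : finite_control m A ->
  cos_law P (fun w => theta * M A w) (fine (m A) * `|theta| `^ gamma)
    (fine (m A) * (`|theta| `^ gamma * (Num.sg theta * skew))).
Proof.
move=> fA c.
have := srm_char_fun M_stable fA theta.
rewrite /char_fun /cexp /stable_exponent.
set q := `|theta| `^ gamma; set mA := fine (m A).
set p := mA * (q * (Num.sg theta * skew)).
move=> /(f_equal (fun z : R[i] => (complex.Re z, complex.Im z))) /= [Ec Es].
have {}Ec : \int[distribution P (M A)]_x cos (theta * x) = expR (- (mA * q)) * cos p.
  by rewrite Ec [X in _ - X]mul0r subr0; congr (expR _ * cos _); rewrite ?/p; ring.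
have {}Es : \int[distribution P (M A)]_x sin (theta * x) = expR (- (mA * q)) * sin p.
  by rewrite Es [X in _ + X]mul0r addr0; congr (expR _ * sin _); rewrite ?/p; ring.
have mcos : measurable_fun setT (@cos R).
  by apply: continuous_measurable_fun; exact: continuous_cos.
have msin : measurable_fun setT (@sin R).
  by apply: continuous_measurable_fun; exact: continuous_sin.
have mX : measurable_fun setT (fun w => theta * M A w) by exact: measurable_funM.
have ic : P.-integrable setT (EFin \o (fun w => cos (theta * M A w))).
  by apply: (@bounded_integrable _ _ _ _ _ 1) => [|w]; [exact: measurableT_comp|exact: cos_max].
have is_ : P.-integrable setT (EFin \o (fun w => sin (theta * M A w))).
  by apply: (@bounded_integrable _ _ _ _ _ 1) => [|w]; [exact: measurableT_comp|exact: sin_max].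
have transfer (f : R -> R) : measurable_fun setT f -> 
    P.-integrable setT (EFin \o (fun w => f (theta * M A w))) ->
    \int[distribution P (M A)]_x f (theta * x) = \int[P]_w f (theta * M A w).
  move=> mf intf; rewrite /Rintegral integral_distribution//.
  by apply/measurable_EFinP; apply: measurableT_comp => //; exact: measurable_funM.
rewrite transfer// in Ec; rewrite transfer// in Es.
transitivity (cos c * \int[P]_w cos (theta * M A w) - sin c * \int[P]_w sin (theta * M A w)).
  rewrite -!RintegralZl// -RintegralB//.
  - by apply: eq_Rintegral => w _; rewrite cosD; ring.
  - exact: (integrableZl measurableT (cos c) ic).
  - exact: (integrableZl measurableT (sin c) is_).
by rewrite Ec Es cosD; ring.
Qed.

Lemma finite_control0 : finite_control m set0.
Proof. by split => //; rewrite measure0. Qed.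

(** Sigma-additivity for the constant sequence set0 says that n M(set0) converges
    to M(set0). *)
Lemma stable_random_measure0 : {ae P, forall w, M set0 w = 0}.
Proof.
have tr : trivIset setT (fun _ : nat => set0 : set T).
  by move=> i j _ _; rewrite set0I => -[].
have := srm_sigma_additive M_stable (fun=> finite_control0) tr.
rewrite bigcup_const; last by exists 0%N.
move=> /(_ finite_control0); apply: filterS => w h.
have h1 : (M set0 w *+ n) @[n --> \oo] --> (M set0 w : R).
  by apply: cvg_trans h; under [X in _ --> X @ _]eq_fun do rewrite sumr_const_nat subn0.
have h2 : (M set0 w *+ n.+1) @[n --> \oo] --> (M set0 w : R).
  by move: h1; rewrite -cvg_shiftS.
have h3 : (M set0 w *+ n.+1 - M set0 w *+ n) @[n --> \oo] --> (M set0 w - M set0 w : R).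
  exact: cvgB.
rewrite subrr in h3; have <- := cvg_lim (@Rhausdorff R) h3.
by under eq_fun do rewrite mulrS addrK; rewrite lim_cst.
Qed.

Lemma stable_random_measure_additive n (A : 'I_n -> set T) :
  (forall i, finite_control m (A i)) -> trivIset setT A ->
  {ae P, forall w, M (\bigcup_(i in [set: 'I_n]) A i) w = \sum_(i < n) M (A i) w}.
Proof.
move=> fA tA.
pose B k := if insub k is Some i then A i else set0.
have Bord (i : 'I_n) : B i = A i by rewrite /B valK.
have Bge k : (n <= k)%N -> B k = set0 by move=> nk; rewrite /B insubF// ltnNge nk.
have fB k : finite_control m (B k).
  by rewrite /B; case: insub => [i|]//; exact: finite_control0.
have tB : trivIset setT B.
  move=> j k _ _; rewrite /B; case: insubP => [i _ <-|_]; last by rewrite set0I => -[].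
  case: insubP => [i' _ <-|_]; last by rewrite setI0 => -[].
  by move=> /tA ->.
have UB : \bigcup_k B k = \bigcup_(i in [set: 'I_n]) A i.
  apply/seteqP; split => x [k _].
    by rewrite /B; case: insubP => // i _ _ Ax; exists i.
  by rewrite -Bord => Bx; exists k.
have fU : finite_control m (\bigcup_k B k).
  split; first by apply: bigcup_measurable => k _; exact: (fB k).1.
  have -> : \bigcup_k B k = \big[setU/set0]_(k < n) B k.
    rewrite -bigcup_mkord; apply/seteqP; split => x [k kn Bx]; last by exists k.
    by exists k => //=; rewrite ltnNge; apply/negP => /Bge Bk; rewrite Bk in Bx.
  apply: le_lt_trans (Boole_inequality m (fun k _ => (fB k).1)) _.
  by apply: lte_sum_pinfty => k _; exact: (fB k).2.
have := srm_sigma_additive M_stable fB tB fU; apply: filterS2 stable_random_measure0 => w M0 h.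
rewrite -UB -(cvg_lim (@Rhausdorff R) h); apply/cvg_lim => //.
apply: cvg_near_cst; near=> k.
have nk : (n <= k)%N by near: k; exact: nbhs_infty_ge.
rewrite (@big_cat_nat _ _ _ n)//=.
rewrite [X in _ + X]big_nat_cond [X in _ + X]big1 ?addr0.
  by rewrite big_mkord; apply: eq_bigr => i _; rewrite Bord.
by move=> j; rewrite andbT => /andP[/Bge -> _].
Unshelve. all: by end_near. Qed.

End stable_random_measures.

(** * Integrals of simple functions *)

Section common_partition.
Context d (T : measurableType d) (R : realType).

(** The cells are indexed by the tuples of indices of the values of the g i; v
    reads off the values. *)
Lemma common_partition n (g : 'I_n -> {sfun T >-> R}) :
  exists N (k : T -> 'I_N) (v : 'I_n -> 'I_N -> R),
    (forall j, measurable (k @^-1` [set j])) /\ (forall i x, g i x = v i (k x)).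
Proof.
pose s i : seq R := finmap.enum_fset (fset_set (range (g i))).
have sP i x : g i x \in s i by rewrite in_fset_set ?inE.
pose L := (\max_(i < n) size (s i)).+1.
have sL i : (size (s i) < L)%N by rewrite ltnS; apply: (leq_bigmax_cond i).
pose J := {ffun 'I_n -> 'I_L}.
pose k0 x : J := [ffun i => inord (index (g i x) (s i))].
have vk i x : nth 0 (s i) (k0 x i) = g i x.
  rewrite ffunE inordK ?nth_index//.
  by rewrite (leq_ltn_trans _ (sL i))// index_size.
pose e (j : 'I_#|{: J}|) : J := enum_val j.
have eK x : e (enum_rank (k0 x)) = k0 x by rewrite /e enum_rankK.
exists #|{: J}|, (fun x => enum_rank (k0 x)), (fun i j => nth 0 (s i) (e j i)).
split=> [j|i x]; last by rewrite eK vk.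
have -> : (fun x => enum_rank (k0 x)) @^-1` [set j] =
    \bigcap_(i in [set: 'I_n])
      (if (e j i < size (s i))%N then g i @^-1` [set nth 0 (s i) (e j i)]
       else set0).
  apply/seteqP; split => x /=.
    move=> <- i _; rewrite eK ifT ?vk//= ffunE inordK ?index_mem//.
    by rewrite (leq_ltn_trans _ (sL i))// index_size.
  move=> h; rewrite -[RHS]enum_valK; congr enum_rank; apply/ffunP => i; rewrite ffunE.
  have := h i I; case: ifPn => // js /= ->.
  by rewrite index_uniq ?finmap.fset_uniq// inord_val.
by apply: fin_bigcap_measurable => // i _; case: ifP.
Qed.

End common_partition.

Lemma cos_law_ae d (T : measurableType d) (R : realType) (P : probability T R)
    (X Y : T -> R) a p : measurable_fun setT X -> measurable_fun setT Y ->
  {ae P, forall w, X w = Y w} -> cos_law P Y a p -> cos_law P X a p.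
Proof.
move=> mX mY XY h c; rewrite -h; congr fine.
have mc (Z : T -> R) : measurable_fun setT Z ->
    measurable_fun setT (fun w => (cos (Z w + c))%:E).
  move=> mZ; apply/measurable_EFinP; apply: measurableT_comp; last exact: measurable_funD.
  by apply: continuous_measurable_fun; exact: continuous_cos.
apply: ae_eq_integral => //; [exact: mc|exact: mc|].
by apply: filterS XY => w XYw _; rewrite XYw.
Qed.

Section simple_integrals.
Context dO (Omega : measurableType dO) (R : realType) (P : probability Omega R).
Context d (T : measurableType d).
Variables (gamma b : R) (m : {measure set T -> \bar R}) (M : set T -> {RV P >-> R}).
Hypothesis M_stable : stable_random_measure gamma b m M.

(** Each level set of g, except that of 0, is a union of cells, and M is almost
    surely finitely additive.  The cells where g vanishes may have infinite
    measure; D is free there. *)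
Lemma simple_stable_integral_partition (g : {sfun T >-> R}) N (k : T -> 'I_N)
    (v : 'I_N -> R) (D : 'I_N -> set T) :
  simple_integrand m g -> (forall x, g x = v (k x)) ->
  (forall j, v j != 0 -> D j = k @^-1` [set j]) ->
  (forall j, finite_control m (D j)) -> trivIset setT D ->
  {ae P, forall w, simple_stable_integral M g w = \sum_(j < N) v j * M (D j) w}.
Proof.
move=> sg gv Dk fD tD.
pose rg : seq R := finmap.enum_fset (fset_set (range g)).
pose D' c j := if v j == c then D j else set0.
have level c : c != 0 -> g @^-1` [set c] = \bigcup_(j in [set: 'I_N]) D' c j.
  move=> c0; apply/seteqP; split => x /=.
    move=> gx; exists (k x) => //; rewrite /D' -gv gx eqxx Dk//.
    by rewrite -gv gx.
  move=> [j _]; rewrite /D'; case: eqP => // vj.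
  by rewrite Dk ?vj// => /= kx; rewrite gv kx.
have fD' c j : finite_control m (D' c j).
  by rewrite /D'; case: ifP => // _; exact: finite_control0.
have tD' c : trivIset setT (D' c).
  move=> i j _ _ [x []]; rewrite /D'; case: ifP => // _ Dx; case: ifP => // _ Dx'.
  by apply: tD => //; exists x.
have add c := stable_random_measure_additive M_stable (fD' c) (tD' c).
have all_add : {ae P, forall w, forall c, c \in rg ->
    M (\bigcup_(j in [set: 'I_N]) D' c j) w = \sum_(j < N) M (D' c j) w}.
  elim: rg => [|c l IHl]; first by apply: aeW => w c.
  apply: filterS2 (add c) IHl => w hc hl c'; rewrite in_cons => /predU1P[->//|].
  exact: hl.
apply: filterS2 (stable_random_measure0 M_stable) all_add => w M0 h.
rewrite /simple_stable_integral fsbig_finite//=.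
transitivity (\sum_(c <- rg) \sum_(j < N) (v j == c)%:R * (v j * M (D j) w)).
  rewrite big_seq [RHS]big_seq; apply: eq_bigr => c crg.
  have [->|c0] := eqVneq c 0.
    rewrite mul0r big1// => j _; have [->|_] := eqVneq (v j) 0; rewrite ?mul0r ?mulr0//.
  rewrite level// h// mulr_sumr; apply: eq_bigr => j _; rewrite /D'.
  by have [->|_] := eqVneq (v j) c; rewrite ?mul1r// M0 mulr0 mul0r.
rewrite exchange_big/=; apply: eq_bigr => j _.
have [vj|vj] := boolP (v j \in rg).
  rewrite (bigD1_seq (v j))/= ?finmap.fset_uniq// eqxx mul1r big1 ?addr0// => c /negPf cv.
  by rewrite eq_sym cv mul0r.
have [->|v0] := eqVneq (v j) 0.
  by rewrite mul0r big1// => c _; rewrite mulr0.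
have -> : D j = set0.
  rewrite Dk//; apply/seteqP; split => x //= kx.
  by move: vj; rewrite in_fset_set// notin_setE/=; apply; exists x => //; rewrite gv kx.
by rewrite M0 mulr0 big1// => c _; rewrite mulr0.
Qed.

Local Notation skew := (b * tan (pi * gamma / 2)).

(** The positive and negative halves of |x|^gamma: their sum is |x|^gamma and
    their difference is the signed power that enters the skewness. *)
Definition pos_power (x : R) := Num.max x 0 `^ gamma.
Definition neg_power (x : R) := Num.max (- x) 0 `^ gamma.

Definition power_integral (phi : R -> R) (h : T -> R) : R :=
  fine (\int[m]_x (phi (h x))%:E).

(** On the cells D j of a common partition the linear combination is almost surely
    sum_j u_j M(D j), a sum of independent variables whose exponents add up. *)
Lemma simple_cos_law n (g : 'I_n -> {sfun T >-> R}) (X : 'I_n -> {RV P >-> R})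
    (theta : 'I_n -> R) (H := fun x => \sum_(i < n) theta i * g i x) :
  0 < gamma -> (forall i, simple_integrand m (g i)) ->
  (forall i, X i =1 simple_stable_integral M (g i)) ->
  cos_law P (fun w => \sum_(i < n) theta i * X i w)
    (power_integral pos_power H + power_integral neg_power H)
    (skew * (power_integral pos_power H - power_integral neg_power H)).
Proof.
move=> g0 sg XE.
have [N [k [v [mk gv]]]] := common_partition g.
(* the cells where all the integrands vanish, the only ones that may have
   infinite measure, are emptied *)
pose D j := if [exists i, v i j != 0] then k @^-1` [set j] else set0.
have fD j : finite_control m (D j).
  rewrite /D; case: ifPn => [/existsP[i vij]|_]; last exact: finite_control0.
  split => //; apply: le_lt_trans (sg i _ vij).
  apply: le_measure; rewrite ?inE//.
  by move=> x /= <-; rewrite gv.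
have Dk j : D j `<=` k @^-1` [set j] by rewrite /D; case: ifP => _ x.
have tD : trivIset setT D by move=> i j _ _ [x [/Dk <- /Dk <-]].
have DE i j : v i j != 0 -> D j = k @^-1` [set j].
  by move=> vij; rewrite /D ifT//; apply/existsP; exists i.
pose u j := \sum_(i < n) theta i * v i j.
have HE x : H x = u (k x) by apply: eq_bigr => i _; rewrite gv.
have powE (phi : R -> R) : (forall x, 0 <= phi x) -> phi 0 = 0 ->
    power_integral phi H = \sum_(j < N) fine (m (D j)) * phi (u j).
  move=> phi_ge0 phi0; rewrite /power_integral.
  have E x : (phi (H x))%:E = (\sum_(j < N) (phi (u j))%:E * (\1_(D j) x)%:E)%E.
    rewrite HE (bigD1 (k x))//= big1 ?adde0.
      have [u0|u0] := eqVneq (u (k x)) 0; first by rewrite u0 phi0 mul0e.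
      rewrite indicE mem_set ?mule1//.
      rewrite /D ifT//; apply/existsP; apply/existsP; apply: contraNT u0.
      rewrite negb_exists => /forallP v0; apply/eqP/big1 => i _.
      by have := v0 i; rewrite negbK => /eqP ->; rewrite mulr0.
    move=> j jk; rewrite indicE memNset ?mule0// => /Dk /= kx.
    by rewrite kx eqxx in jk.
  under eq_integral do rewrite E.
  rewrite ge0_integral_sum//.
  - transitivity (fine (\sum_(j < N) ((fine (m (D j)) * phi (u j))%:E))%E).
      congr fine; apply: eq_bigr => j _.
      have [mD mDy] := fD j.
      have mI : measurable_fun setT (fun x : T => (\1_(D j) x)%:E : \bar R).
        exact/measurable_EFinP/measurable_indic.
      rewrite ge0_integralZl ?lee_fin//.
      rewrite integral_indic// setIT muleC EFinM fineK//.
      by rewrite ge0_fin_numE ?measure_ge0.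
    by rewrite sumEFin.
  - move=> j; apply/measurable_EFinP; apply: measurable_funM => //.
    by apply: measurable_indic; exact: (fD j).1.
  by move=> j x _; rewrite mule_ge0 ?lee_fin.
have pos0 : pos_power 0 = 0 by rewrite /pos_power maxxx powR0// gt_eqF.
have neg0 : neg_power 0 = 0 by rewrite /neg_power oppr0 maxxx powR0// gt_eqF.
have pos_negD x : `|x| `^ gamma = pos_power x + neg_power x.
  rewrite /pos_power /neg_power; have [x0|x0] := leP 0 x.
    by rewrite ger0_norm// (max_r (_ : - x <= 0)) ?oppr_le0// powR0 ?gt_eqF// addr0.
  by rewrite ltr0_norm// max_l ?oppr_ge0 ?ltW// powR0 ?gt_eqF// add0r.
have pos_negB x : `|x| `^ gamma * Num.sg x = pos_power x - neg_power x.
  rewrite /pos_power /neg_power; have [x0|x0|->] := ltgtP x 0.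
  - rewrite ltr0_norm// ltr0_sg// mulrN1 max_l ?oppr_ge0 ?ltW// powR0 ?gt_eqF//.
    by rewrite sub0r.
  - rewrite gtr0_norm// gtr0_sg// mulr1 max_r ?oppr_le0 ?ltW// powR0 ?gt_eqF//.
    by rewrite subr0.
  - by rewrite sgr0 mulr0 oppr0 maxxx subrr.
rewrite (powE pos_power) ?(powE neg_power)//; try by move=> x; exact: powR_ge0.
pose X' j : {RV P >-> R} :=
  (cst (u j) : {mfun Omega >-> R}) * (M (D j) : {mfun Omega >-> R}).
have indep : mutually_independent X'.
  move=> B mB.
  have := srm_independently_scattered M_stable fD tD (B := fun j => ( *%R (u j)) @^-1` B j).
  apply => j; rewrite -[X in measurable X]setTI.
  by apply: measurable_funM => //; exact: mB.
have claw j : cos_law P (X' j) (fine (m (D j)) * `|u j| `^ gamma)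
    (fine (m (D j)) * (`|u j| `^ gamma * (Num.sg (u j) * skew))).
  exact: (stable_random_measure_cos_law M_stable (u j) (fD j)).
have := cos_law_sum indep claw.
have -> : \sum_(j < N) fine (m (D j)) * `|u j| `^ gamma =
    \sum_(j < N) fine (m (D j)) * pos_power (u j) + \sum_(j < N) fine (m (D j)) * neg_power (u j).
  by rewrite -big_split; apply: eq_bigr => j _; rewrite pos_negD mulrDr.
have -> : \sum_(j < N) fine (m (D j)) * (`|u j| `^ gamma * (Num.sg (u j) * skew)) =
    skew * (\sum_(j < N) fine (m (D j)) * pos_power (u j) -
            \sum_(j < N) fine (m (D j)) * neg_power (u j)).
  rewrite -sumrB mulr_sumr; apply: eq_bigr => j _.
  by rewrite [_ `^ _ * _]mulrA pos_negB; ring.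
apply: cos_law_ae.
- by apply: measurable_sum => i; apply: measurable_funM => //; exact: measurable_funPT.
- by apply: measurable_sum => j; exact: measurable_funPT.
have all_part : {ae P, forall w, forall i : 'I_n,
    X i w = \sum_(j < N) v i j * M (D j) w}.
  have H1 i : {ae P, forall w, X i w = \sum_(j < N) v i j * M (D j) w}.
    have := simple_stable_integral_partition (sg i) (gv i) (DE i) fD tD.
    by apply: filterS => w <-; exact: XE.
  have : {ae P, forall w, forall i, i \in enum 'I_n -> X i w = \sum_(j < N) v i j * M (D j) w}.
    elim: (enum 'I_n) => [|i l IHl]; first by apply: aeW => w i.
    apply: filterS2 (H1 i) IHl => w hi hl i'; rewrite in_cons => /predU1P[->//|].
    exact: hl.
  by apply: filterS => w h i; apply: h; rewrite mem_enum.
apply: filterS all_part => w h.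
under eq_bigr do rewrite h mulr_sumr.
rewrite exchange_big/=; apply: eq_bigr => j _.
transitivity (u j * M (D j) w) => //; rewrite mulr_suml.
by apply: eq_bigr => i _; rewrite mulrA.
Qed.

End simple_integrals.

(** * Continuity of powers, cosines and norms *)

Section powers.
Variable R : realType.

Lemma cvg_powR_ge0 (u : R^nat) (l gamma : R) : 1 <= gamma -> (forall n, 0 <= u n) ->
  u n @[n --> \oo] --> l -> u n `^ gamma @[n --> \oo] --> l `^ gamma.
Proof.
move=> g1 u0 ul; have g0 : 0 < gamma by apply: lt_le_trans g1.
have l0 : 0 <= l.
  by rewrite -(cvg_lim _ ul)//; apply: limr_ge; [exact: cvgP ul|apply: nearW => n].
have [l00|lN0] := eqVneq l 0; last first.
  have lgt0 : 0 < l by rewrite lt_neqAle eq_sym lN0.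
  apply: (@continuous_cvg _ _ _ _ _ _ (fun x => x `^ gamma)) ul.
  apply/differentiable_continuous/derivable1_diffP.
  by apply: derivable_powR; rewrite in_itv/= lgt0.
rewrite l00 powR0 ?gt_eqF//; rewrite l00 in ul.
apply: (@squeeze_cvgr _ _ _ _ (fun=> 0) u) => //; last exact: cvg_cst.
have /cvgrPdist_lt/(_ 1 ltr01) := ul; apply: filterS => n.
rewrite sub0r normrN ger0_norm// => un1; rewrite powR_ge0/=.
have [->|un0] := eqVneq (u n) 0; first by rewrite powR0// gt_eqF.
by apply: ge1r_powR => //; rewrite lt_neqAle eq_sym un0 u0/= ltW.
Qed.

Lemma ler_norm_sin (x : R) : `|sin x| <= `|x|.
Proof.
have le0 (y : R) : 0 <= y -> `|sin y| <= y.
  move=> y0; have [|c _] := @MVT_segment R sin cos 0 y y0 (fun x _ => is_derive_sin x).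
    by apply: continuous_subspaceT => z; exact: continuous_sin.
  rewrite sin0 !subr0 => ->; rewrite normrM (ger0_norm y0).
  by rewrite ler_piMl// cos_max.
have [x0|x0] := leP 0 x; first by rewrite (ger0_norm x0) le0.
by rewrite -normrN -sinN -[leRHS]normrN (ger0_norm (_ : 0 <= - x)) ?le0// oppr_ge0 ltW.
Qed.

Lemma ler_dist_cos (x y : R) : `|cos x - cos y| <= `|x - y|.
Proof.
pose s := (x + y) / 2; pose t := (x - y) / 2.
have -> : cos x - cos y = - (2 * (sin s * sin t)).
  have xE : x = s + t by rewrite /s /t; field.
  have yE : y = s - t by rewrite /s /t; field.
  by rewrite [in LHS]xE [in LHS]yE cosD cosB; ring.
rewrite normrN normrM ger0_norm// normrM.
have -> : `|x - y| = 2 * `|t|.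
  by rewrite /t normrM (ger0_norm (_ : 0 <= 2^-1)) ?invr_ge0// mulrCA divff// mulr1.
rewrite ler_wpM2l// (le_trans (ler_piMl _ (sin_max s)))//.
exact: ler_norm_sin.
Qed.

End powers.

Section Lnorm_limits.
Context d (T : measurableType d) (R : realType) (m : {measure set T -> \bar R}).
Variable gamma : R.
Hypothesis gamma1 : 1 <= gamma.
Let poweR_abse (r : R) : (`|r%:E| `^ gamma = (`|r| `^ gamma)%:E)%E.
Proof. exact: poweR_EFin. Qed.
Let gamma0 : 0 < gamma. Proof. exact: lt_le_trans gamma1. Qed.

Local Notation nm f := (Lnorm m gamma%:E (EFin \o f)).

Let measurable_power (f : T -> R) : measurable_fun setT f ->
  measurable_fun setT (fun x => (`|(f x)%:E| `^ gamma)%E).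
Proof.
move=> mf; rewrite (_ : (fun x => _) = EFin \o (fun x => `|f x| `^ gamma)).
  apply/measurable_EFinP; apply: measurableT_comp (measurable_powR _) _.
  exact: measurableT_comp.
by apply/funext => x; exact: poweR_EFin.
Qed.

Lemma le_Lnorm (f g : T -> R) : measurable_fun setT f -> measurable_fun setT g ->
  (forall x, `|f x| <= `|g x|) -> (nm f <= nm g)%E.
Proof.
move=> mf mg fg; rewrite unlock /=.
have i0 (h : T -> R) : (0 <= \int[m]_x `|(h x)%:E| `^ gamma)%E.
  by apply: integral_ge0 => x _; exact: poweR_ge0.
apply: gt0_ler_poweR; rewrite ?in_itv/= ?leey ?i0 ?invr_ge0 ?(ltW gamma0)//.
apply: ge0_le_integral => //.
- exact: measurable_power.
- exact: measurable_power.
- move=> x _; rewrite lee_fin ge0_ler_powR ?nnegrE ?(ltW gamma0)//.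
Qed.

Lemma Lnorm_scale (a : R) (f : T -> R) : measurable_fun setT f ->
  nm (fun x => a * f x) = (`|a|%:E * nm f)%E.
Proof.
move=> mf; rewrite unlock /=.
have -> : (\int[m]_x `|(a * f x)%:E| `^ gamma =
    (`|a| `^ gamma)%:E * \int[m]_x `|(f x)%:E| `^ gamma)%E.
  rewrite -ge0_integralZl ?lee_fin ?powR_ge0//; last 2 first.
  - exact: measurable_power.
  - by move=> x _; exact: poweR_ge0.
  by apply: eq_integral => x _; rewrite !poweR_abse -EFinM normrM powRM.
rewrite poweRM ?lee_fin ?powR_ge0//; last by apply: integral_ge0 => x _; exact: poweR_ge0.
by rewrite poweR_EFin -powRrM divff ?gt_eqF// powRr1.
Qed.

Lemma cvg_Lnorm_sum I (s : seq I) (f : I -> nat -> T -> R) :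
  (forall i n, measurable_fun setT (f i n)) ->
  (forall i, nm (f i n) @[n --> \oo] --> 0%E) ->
  nm (fun x => \sum_(i <- s) f i n x) @[n --> \oo] --> 0%E.
Proof.
move=> mf f0; elim: s => [|i s IHs].
  under eq_fun do under eq_fun do rewrite big_nil.
  rewrite (_ : (fun n : nat => _) = cst 0%E); first exact: cvg_cst.
  by apply/funext => n; rewrite -[RHS](@Lnorm0 _ _ _ m gamma%:E)// eqe gt_eqF.
apply: (@squeeze_cvge _ _ _ _ (fun=> 0%E) _
    (fun n => (nm (f i n) + nm (fun x => (\sum_(j <- s) f j n x)%R))%E)).
- apply: nearW => n; rewrite Lnorm_ge0/=.
  under eq_fun do rewrite big_cons.
  apply: minkowski_EFin => //; exact: measurable_sum.
- exact: cvg_cst.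
- by rewrite -[X in _ --> X]adde0; apply: cvgeD.
Qed.

(** A 1-Lipschitz map fixing 0 acts continuously on L^gamma; it is used for the
    positive and negative parts. *)
Lemma cvg_Lnorm_lipschitz (kappa : R -> R) (H_ : nat -> T -> R) (H : T -> R) :
  measurable_fun setT kappa -> (forall x y, `|kappa x - kappa y| <= `|x - y|) ->
  kappa 0 = 0 -> (forall n, measurable_fun setT (H_ n)) -> measurable_fun setT H ->
  (nm H < +oo)%E -> nm (fun x => H_ n x - H x) @[n --> \oo] --> 0%E ->
  fine (nm (fun x => kappa (H_ n x))) @[n --> \oo] --> fine (nm (fun x => kappa (H x))).
Proof.
move=> mk klip k0 mH_ mH Hoo h.
have mkH : measurable_fun setT (fun x => kappa (H x)) by exact: measurableT_comp.
have mkH_ n : measurable_fun setT (fun x => kappa (H_ n x)) by exact: measurableT_comp.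
have kHfin : nm (fun x => kappa (H x)) \is a fin_num.
  rewrite ge0_fin_numE ?Lnorm_ge0// (le_lt_trans _ Hoo)//.
  by apply: le_Lnorm => // x; have := klip (H x) 0; rewrite k0 !subr0.
have mdif n : measurable_fun setT (fun x => H_ n x - H x) by exact: measurable_funB.
have mkdif n : measurable_fun setT (fun x => kappa (H_ n x) - kappa (H x)).
  exact: measurable_funB.
have mkdif' n : measurable_fun setT (fun x => kappa (H x) - kappa (H_ n x)).
  exact: measurable_funB.
have up n : (nm (fun x => kappa (H_ n x)) <=
    nm (fun x => kappa (H x)) + nm (fun x => (H_ n x - H x)%R))%E.
  apply: (@le_trans _ _ (nm (fun x => kappa (H x)) +
                         nm (fun x => (kappa (H_ n x) - kappa (H x))%R))%E).
    rewrite (_ : (fun x => kappa (H_ n x)) =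
      ((fun x => kappa (H x)) \+ (fun x => kappa (H_ n x) - kappa (H x)))%R).
      exact: minkowski_EFin.
    by apply/funext => x /=; rewrite addrC subrK.
  by rewrite leeD2l// le_Lnorm.
have lo n : (nm (fun x => kappa (H x)) <=
    nm (fun x => kappa (H_ n x)) + nm (fun x => (H_ n x - H x)%R))%E.
  apply: (@le_trans _ _ (nm (fun x => kappa (H_ n x)) +
                         nm (fun x => (kappa (H x) - kappa (H_ n x))%R))%E).
    rewrite {1}(_ : (fun x => kappa (H x)) =
      ((fun x => kappa (H_ n x)) \+ (fun x => kappa (H x) - kappa (H_ n x)))%R).
      exact: minkowski_EFin.
    by apply/funext => x /=; rewrite addrC subrK.
  by rewrite leeD2l// le_Lnorm// => x; rewrite [leRHS]distrC.
apply: fine_cvg; rewrite fineK//.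
have /fine_cvgP[hfin _] := h.
pose A := nm (fun x => kappa (H x)).
apply: (@squeeze_cvge _ _ _ _ (fun n => A - nm (fun x => (H_ n x - H x)%R))%E _
    (fun n => A + nm (fun x => (H_ n x - H x)%R))%E).
- by apply: filterS hfin => n hn; rewrite up andbT leeBlDr// lo.
- by rewrite -[X in _ --> X]sube0; apply: cvgeB => //; [rewrite fin_num_adde_defr|exact: cvg_cst].
- by rewrite -[X in _ --> X]adde0; apply: cvgeD => //; [rewrite fin_num_adde_defr|exact: cvg_cst].
Qed.

End Lnorm_limits.

(** * Limits in probability and stable integrals *)

Section limits_in_probability.
Context dO (Omega : measurableType dO) (R : realType) (P : probability Omega R).

(** The difference of the cosines is at most e times the sum of the |theta_i|
    where all the |X_ i k - X i| are below e, and at most 2 elsewhere. *)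
Lemma cvg_in_probability_cos n (X_ : 'I_n -> {RV P >-> R}^nat)
    (X : 'I_n -> {RV P >-> R}) (theta : 'I_n -> R) (c : R) :
  (forall i, cvg_in_probability (X_ i) (X i)) ->
  (\int[P]_w cos (\sum_(i < n) theta i * X_ i k w + c)) @[k --> \oo] -->
  (\int[P]_w cos (\sum_(i < n) theta i * X i w + c)).
Proof.
move=> cvX; apply/cvgrPdist_le => eps eps0.
pose S := \sum_(i < n) `|theta i|.
have S0 : 0 <= S by apply: sumr_ge0.
(* S + 1 rather than S, which may be 0 *)
pose e := eps / (2 * (S + 1)).
have e0 : 0 < e by rewrite divr_gt0// mulr_gt0// ltr_wpDl.
have eS : S * e <= eps / 2.
  rewrite /e mulrA ler_pdivrMr ?mulr_gt0 ?ltr_wpDl//.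
  rewrite (_ : eps / 2 * (2 * (S + 1)) = eps * (S + 1)); last by field.
  by rewrite mulrDr mulr1 mulrC lerDl ltW.
pose B i k := [set w | e <= `|X_ i k w - X i w|].
have mB i k : measurable (B i k).
  rewrite (_ : B i k = (fun w => `|X_ i k w - X i w|) @^-1` `[e, +oo[%classic).
    rewrite -[X in measurable X]setTI.
    apply: measurableT_comp => //; apply: measurable_funB; exact: measurable_funPT.
  by apply/seteqP; split => w; rewrite /B /= in_itv/= andbT.
have I1 i k w : \1_(B i k) w <= (1 : R) by rewrite indicE lern1 leq_b1.
have PB0 i : fine (P (B i k)) @[k --> \oo] --> (0 : R).
  by apply: fine_cvg; exact: cvX.
have sum0 : (\sum_(i < n) fine (P (B i k))) @[k --> \oo] --> (0 : R).
  rewrite [X in _ --> X](_ : 0 = \sum_(i < n) (0 : R)); last by rewrite big1.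
  by apply: cvg_big => [|i _]; [exact: add_continuous|exact: PB0].
have mcos : measurable_fun setT (@cos R).
  by apply: continuous_measurable_fun; exact: continuous_cos.
have mW (Y : 'I_n -> {RV P >-> R}) :
    measurable_fun setT (fun w => cos (\sum_(i < n) theta i * Y i w + c)).
  apply: measurableT_comp => //; apply: measurable_funD => //.
  apply: measurable_sum => i; apply: measurable_funM => //; exact: measurable_funPT.
have iW (Y : 'I_n -> {RV P >-> R}) :
    P.-integrable setT (EFin \o (fun w => cos (\sum_(i < n) theta i * Y i w + c))).
  by apply: (@bounded_integrable _ _ _ _ _ 1) => // w; exact: cos_max.
have e2 : 0 < eps / 4 by rewrite divr_gt0.
have /cvgrPdist_le/(_ _ e2) := sum0; apply: filterS => k.
rewrite sub0r normrN ger0_norm; last by apply: sumr_ge0 => i _; rewrite fine_ge0.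
move=> Pk; rewrite -RintegralB//.
set D := fun w => cos (\sum_(i < n) theta i * X i w + c) -
                  cos (\sum_(i < n) theta i * X_ i k w + c).
have iD : P.-integrable setT (EFin \o D).
  exact: (integrableB measurableT (iW X) (iW (fun i => X_ i k))).
pose U w := S * e + \sum_(i < n) 2 * \1_(B i k) w.
have D_le w : `|D w| <= U w.
  have [[i Bi]|noB] := pselect (exists i, B i k w).
    rewrite (@le_trans _ _ 2)//.
      rewrite (le_trans (ler_normB _ _))// (_ : 2 = 1 + 1)// lerD ?cos_max//.
    rewrite /U (bigD1 i)//= indicE mem_set// mulr1 addrCA lerDl addr_ge0//.
      by rewrite mulr_ge0// ltW.
    by apply: sumr_ge0 => j _; rewrite mulr_ge0.
  rewrite (le_trans (ler_dist_cos _ _))//.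
  have -> : U w = S * e.
    rewrite /U big1 ?addr0// => i _.
    by rewrite indicE memNset ?mulr0// => Bi; apply: noB; exists i.
  rewrite opprD addrACA subrr addr0 -sumrB (le_trans (ler_norm_sum _ _ _))//.
  rewrite /S mulr_suml ler_sum// => i _; rewrite -mulrBr normrM ler_wpM2l//.
  by rewrite distrC leNgt; apply/negP => h; apply: noB; exists i; rewrite /B/= ltW.
have iI i : P.-integrable setT (EFin \o (fun w => 2 * \1_(B i k) w)).
  apply: (@bounded_integrable _ _ _ _ _ 2).
    by apply: measurable_funM => //; exact: measurable_indic.
  by move=> w; rewrite ger0_norm ?mulr_ge0// ler_piMr// I1.
have iU : P.-integrable setT (EFin \o U).
  apply: (@bounded_integrable _ _ _ _ _ (S * e + \sum_(i < n) 2)).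
    apply: measurable_funD => //; apply: measurable_sum => i.
    by apply: measurable_funM => //; exact: measurable_indic.
  move=> w; rewrite ger0_norm.
    by rewrite lerD2l ler_sum// => i _; rewrite ler_piMr// I1.
  apply: addr_ge0; first by rewrite mulr_ge0// ltW.
  by apply: sumr_ge0 => i _; rewrite mulr_ge0.
apply: le_trans (le_normr_Rintegral measurableT iD) _.
apply: (@le_trans _ _ (\int[P]_w U w)).
  apply: le_Rintegral => //.
  exact: (integrable_norm iD).
have -> : \int[P]_w U w = S * e + 2 * \sum_(i < n) fine (P (B i k)).
  rewrite /Rintegral; under eq_integral do rewrite EFinD -sumEFin.
  have se0 : (0 <= (S * e)%:E)%E by rewrite lee_fin mulr_ge0// ltW.
  have mI i : measurable_fun setT (fun w => (2 * \1_(B i k) w)%:E : \bar R).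
    exact: (measurable_int _ (iI i)).
  have I0 i w : (0 <= (2 * \1_(B i k) w)%:E :> \bar R)%E by rewrite lee_fin mulr_ge0.
  rewrite ge0_integralD//; last 2 first.
  - by move=> w _; apply: sume_ge0 => i _; exact: I0.
  - by apply: emeasurable_sum => i; exact: mI.
  rewrite integral_cst// ge0_integral_sum//.
  have PT : P [set: Omega] = 1%E := probability_setT P.
  rewrite [X in (_ * X + _)%E]PT mule1.
  have -> : (\sum_(i < n) \int[P]_w (2 * \1_(B i k) w)%:E)%E =
            (\sum_(i < n) (2 * fine (P (B i k)))%:E)%E.
    apply: eq_bigr => i _; under eq_integral do rewrite EFinM.
    rewrite ge0_integralZl//; last exact/measurable_EFinP/measurable_indic.
    by rewrite integral_indic// setIT EFinM fineK// fin_num_measure.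
  by rewrite sumEFin -EFinD/= mulr_sumr.
rewrite (_ : eps = eps / 2 + 2 * (eps / 4)); last by field.
by rewrite lerD// ler_pM2l.
Qed.

Lemma cvg_in_probability_cos_law n (X_ : 'I_n -> {RV P >-> R}^nat)
    (X : 'I_n -> {RV P >-> R}) (theta : 'I_n -> R) (a_ p_ : R^nat) (a p : R) :
  (forall i, cvg_in_probability (X_ i) (X i)) ->
  (forall k, cos_law P (fun w => \sum_(i < n) theta i * X_ i k w) (a_ k) (p_ k)) ->
  a_ k @[k --> \oo] --> a -> p_ k @[k --> \oo] --> p ->
  cos_law P (fun w => \sum_(i < n) theta i * X i w) a p.
Proof.
move=> cvX law cva cvp c.
have h := cvg_in_probability_cos (X := X) (theta := theta) (c := c) cvX.
rewrite -(cvg_lim (@Rhausdorff R) h).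
under eq_fun do rewrite law.
apply/cvg_lim => //; apply: cvgM.
  apply: (@continuous_cvg _ _ _ _ _ _ (@expR R)); first exact: continuous_expR.
  exact: cvgN.
apply: (@continuous_cvg _ _ _ _ _ _ (@cos R)); first exact: continuous_cos.
by apply: cvgD => //; exact: cvg_cst.
Qed.

End limits_in_probability.

Lemma ler_dist_max0 (R : realDomainType) (x y : R) :
  `|Num.max x 0 - Num.max y 0| <= `|x - y|.
Proof.
have := ler_norm (x - y); have := ler_norm (y - x); rewrite (distrC y) ler_norml.
by rewrite /Num.max; do 2 case: ltP => ?; move=> ? ?; apply/andP; split; lra.
Qed.

Section stable_integrals.
Context dO (Omega : measurableType dO) (R : realType) (P : probability Omega R).
Context d (T : measurableType d).
Variables (gamma b : R) (m : {measure set T -> \bar R}) (M : set T -> {RV P >-> R}).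
Hypothesis M_stable : stable_random_measure gamma b m M.
Hypothesis gamma1 : 1 <= gamma.

(** The formula for simple integrands passes to the limit because the power
    integrals are gamma-th powers of L^gamma norms of positive and negative
    parts. *)
Lemma stable_integral_cos_law n (h : 'I_n -> T -> R) (X : 'I_n -> {RV P >-> R})
    (theta : 'I_n -> R) (H := fun x => \sum_(i < n) theta i * h i x) :
  (forall i, is_stable_integral gamma m M (h i) (X i)) ->
  cos_law P (fun w => \sum_(i < n) theta i * X i w)
    (power_integral m (pos_power gamma) H + power_integral m (neg_power gamma) H)
    (b * tan (pi * gamma / 2) *
      (power_integral m (pos_power gamma) H - power_integral m (neg_power gamma) H)).
Proof.
move=> HX; have gamma0 : 0 < gamma by apply: lt_le_trans gamma1.
have /choice[g /choice[Y gY]] : forall i, exists g, exists Y : {RV P >-> R}^nat,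
    [/\ forall k, simple_integrand m (g k),
        Lnorm m gamma%:E (EFin \o (g k \- h i)) @[k --> \oo] --> 0%E,
        forall k, Y k =1 simple_stable_integral M (g k) &
        cvg_in_probability Y (X i)].
  by move=> i; have [_] := HX i.
have mh i : measurable_fun setT (h i).
  by have [/sub_Lfun_mfun] := HX i; rewrite inE.
have hoo i : (Lnorm m gamma%:E (EFin \o h i) < +oo)%E.
  by have [/sub_Lfun_finLfun] := HX i; rewrite inE.
pose H_ k x := \sum_(i < n) theta i * g i k x.
have mg i k : measurable_fun setT (g i k) by exact: measurable_funPT.
have mH_ k : measurable_fun setT (H_ k).
  by apply: measurable_sum => i; exact: measurable_funM.
have mH : measurable_fun setT H by apply: measurable_sum => i; exact: measurable_funM.
have cvH : Lnorm m gamma%:E (EFin \o (fun x => H_ k x - H x)) @[k --> \oo] --> 0%E.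
  have -> : (fun k : nat => Lnorm m gamma%:E (EFin \o (fun x => H_ k x - H x))) =
      (fun k : nat => Lnorm m gamma%:E (EFin \o (fun x =>
        \sum_(i < n) theta i * (g i k x - h i x)))).
    apply/funext => k; congr (Lnorm _ _ (EFin \o _)); apply/funext => x.
    by rewrite -sumrB; apply: eq_bigr => i _; rewrite mulrBr.
  apply: (@cvg_Lnorm_sum _ _ _ m gamma gamma1 _ _
    (fun i k x => theta i * (g i k x - h i x))) => [i k|i].
    by apply: measurable_funM => //; exact: measurable_funB.
  have [_ cvg_g _ _] := gY i.
  have -> : (fun k : nat => Lnorm m gamma%:E (EFin \o (fun x => theta i * (g i k x - h i x)))) =
      (fun k : nat => `|theta i|%:E * Lnorm m gamma%:E (EFin \o (g i k \- h i)%R))%E.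
    by apply/funext => k; rewrite (Lnorm_scale m gamma1)//; exact: measurable_funB.
  by rewrite -[X in _ --> X](mule0 (`|theta i|%:E)); apply: cvgeZl.
have Hoo : (Lnorm m gamma%:E (EFin \o H) < +oo)%E.
  rewrite /H; elim: (index_enum _) => [|i s IHs].
    under eq_fun do rewrite big_nil.
    by rewrite [X in (X < _)%E](@Lnorm0 _ _ _ m gamma%:E)// eqe gt_eqF.
  under eq_fun do rewrite big_cons.
  apply: le_lt_trans (minkowski_EFin m _ _ gamma1) _.
  - exact: measurable_funM.
  - by apply: measurable_sum => j; exact: measurable_funM.
  - by rewrite (Lnorm_scale m gamma1)// lte_add_pinfty// lte_mul_pinfty.
have cv_power (kappa : R -> R) : measurable_fun setT kappa ->
    (forall x y, `|kappa x - kappa y| <= `|x - y|) -> kappa 0 = 0 ->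
    (forall x, 0 <= kappa x) ->
    power_integral m (fun x => kappa x `^ gamma) (H_ k) @[k --> \oo] -->
    power_integral m (fun x => kappa x `^ gamma) H.
  move=> mk lipk k0 k_ge0.
  have E (F : T -> R) : power_integral m (fun x => kappa x `^ gamma) F =
      fine (Lnorm m gamma%:E (EFin \o (fun x => kappa (F x)))) `^ gamma.
    transitivity (fine (Lnorm m gamma%:E (EFin \o (fun x => kappa (F x))) `^ gamma)%E).
      rewrite poweR_Lnorm; last by rewrite gt_eqF.
      congr fine.
      apply: eq_integral => x _.
      by rewrite -poweR_EFin /= ger0_norm.
    exact: fine_poweR.
  rewrite E; under eq_fun do rewrite E.
  apply: cvg_powR_ge0 => //; first by move=> k; rewrite fine_ge0// Lnorm_ge0.
  exact: cvg_Lnorm_lipschitz.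
have cvpos : power_integral m (pos_power gamma) (H_ k) @[k --> \oo] -->
    power_integral m (pos_power gamma) H.
  apply: (cv_power (fun x => Num.max x 0)); [exact: measurable_maxr|exact: ler_dist_max0| |].
  - exact: maxxx.
  - by move=> x; rewrite le_max lexx orbT.
have cvneg : power_integral m (neg_power gamma) (H_ k) @[k --> \oo] -->
    power_integral m (neg_power gamma) H.
  apply: (cv_power (fun x => Num.max (- x) 0)).
  - exact: measurable_maxr.
  - by move=> x y; rewrite (le_trans (ler_dist_max0 _ _))// -opprD normrN.
  - by rewrite oppr0 maxxx.
  - by move=> x; rewrite le_max lexx orbT.
have sg k i : simple_integrand m (g i k) by have [+ _ _ _] := gY i; apply.
have YE k i : Y i k =1 simple_stable_integral M (g i k) by have [_ _ + _] := gY i; apply.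
apply: (@cvg_in_probability_cos_law _ _ _ _ _ Y _ _
  (fun k => power_integral m (pos_power gamma) (H_ k) + power_integral m (neg_power gamma) (H_ k))
  (fun k => b * tan (pi * gamma / 2) * (power_integral m (pos_power gamma) (H_ k)
    - power_integral m (neg_power gamma) (H_ k)))).
- by move=> i; have [_ _ _] := gY i.
- by move=> k; exact: (simple_cos_law M_stable theta gamma0 (sg k) (YE k)).
- by apply: cvgD; [exact: cvpos|exact: cvneg].
- by apply: cvgMr; apply: cvgB; [exact: cvpos|exact: cvneg].
Qed.

End stable_integrals.

(** * Image measures and image fields *)

(** The laws [cos_law] for all the linear combinations amount to the joint
    characteristic functions of X and Y, which determine their joint laws. *)
Lemma same_joint_law dO (Omega : measurableType dO) (R : realType)
    (P : probability Omega R) n (X Y : 'I_n -> Omega -> R) :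
  (forall i, measurable_fun setT (X i)) -> (forall i, measurable_fun setT (Y i)) ->
  (forall theta : 'I_n -> R, exists a p : R,
     cos_law P (fun w => \sum_(i < n) theta i * X i w) a p /\
     cos_law P (fun w => \sum_(i < n) theta i * Y i w) a p) ->
  forall B, measurable B -> joint_law P X B = joint_law P Y B.
Proof.
move=> mX mY same B mB.
pose vec (V : 'I_n -> Omega -> R) w : n.-tuple R := [tuple V i w | i < n].
have mvec V : (forall i, measurable_fun setT (V i)) -> measurable_fun setT (vec V).
  move=> mV; apply/measurable_fun_tnthP => i.
  by apply: (eq_measurable_fun (V i)) => // w _; rewrite /= tnth_mktuple.
pose tX : {mfun Omega >-> n.-tuple R} :=
  HB.pack (vec X) (isMeasurableFun.Build _ _ _ _ _ (mvec X mX)).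
pose tY : {mfun Omega >-> n.-tuple R} :=
  HB.pack (vec Y) (isMeasurableFun.Build _ _ _ _ _ (mvec Y mY)).
suff h theta c : \int[distribution P tX]_x cos (linear_form theta x + c) =
    \int[distribution P tY]_x cos (linear_form theta x + c).
  exact: (eq_measure_of_cos h mB).
have mcos : measurable_fun setT (@cos R).
  by apply: continuous_measurable_fun; exact: continuous_cos.
have mlin : measurable_fun setT (fun x : n.-tuple R => cos (linear_form theta x + c)).
  apply: measurableT_comp => //; apply: measurable_funD => //.
  exact: measurable_linear_form.
have E V (tV : {mfun Omega >-> n.-tuple R}) : tV =1 vec V ->
    \int[distribution P tV]_x cos (linear_form theta x + c) =
    \int[P]_w cos (\sum_(i < n) theta i * V i w + c).
  move=> tVE; rewrite /Rintegral integral_distribution/=.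
  - congr fine; apply: eq_integral => w _ /=; rewrite tVE; congr (cos (_ + c))%:E.
    by apply: eq_bigr => i _; rewrite tnth_mktuple.
  - exact/measurable_EFinP.
  - apply: (@bounded_integrable _ _ _ _ _ 1) => [|w]; last exact: cos_max.
    by apply: (measurableT_comp mlin); exact: measurable_funPT.
rewrite (E X)// (E Y)//; have [a [p [-> ->]]] := same theta.
by [].
Qed.

Section scaled_measures.
Context d (T : measurableType d) (R : realType) (m : {measure set T -> \bar R}).
Variables (f : {mfun T >-> T}) (finv : T -> T) (kappa : R).
Hypotheses (kappa0 : 0 < kappa) (mfinv : measurable_fun setT finv).
Hypothesis fK : cancel f finv.
Hypothesis fm : forall A, measurable A -> m (f @^-1` A) = (kappa%:E * m A)%E.

Lemma ge0_integral_scaled_measure D (g : T -> \bar R) :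
  measurable D -> measurable_fun setT g -> (forall x, (0 <= g x)%E) ->
  (\int[m]_(x in f @^-1` D) g (f x) = kappa%:E * \int[m]_(y in D) g y)%E.
Proof.
move=> mD mg g0; have mf : measurable_fun setT f by exact: measurable_funPT.
have k0 : 0 <= kappa by exact: ltW.
transitivity (\int[pushforward m f]_(y in D) g y)%E.
  by rewrite ge0_integral_pushforward//; exact: measurable_funTS.
transitivity (\int[mscale (NngNum k0) m]_(y in D) g y)%E.
  by apply: eq_measure_integral => A mA _; exact: fm.
by rewrite ge0_integral_mscale//; exact: measurable_funTS.
Qed.

Lemma integral_scaled_measure D (g : T -> \bar R) :
  measurable D -> measurable_fun setT g -> m.-integrable D g ->
  (\int[m]_(x in f @^-1` D) g (f x) = kappa%:E * \int[m]_(y in D) g y)%E.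
Proof.
move=> mD mg intg; rewrite [in LHS]integralE [in RHS]integralE.
rewrite muleBr//; last first.
  by apply: fin_num_adde_defr; apply: integrable_pos_fin_num.
rewrite -!ge0_integral_scaled_measure//; [|exact: measurable_funeneg|exact: measurable_funepos].
by congr (_ - _)%E; apply: eq_integral => x _; rewrite ?funeposE ?funenegE.
Qed.

Lemma fine_pmul (x : \bar R) : fine (kappa%:E * x)%E = kappa * fine x.
Proof.
case: x => [r//||]; rewrite mulr0.
  by rewrite gt0_muley.
by rewrite gt0_muleNy.
Qed.

Lemma power_integral_scaled_measure (phi : R -> R) (F : T -> R) :
  measurable_fun setT phi -> (forall x, 0 <= phi x) -> measurable_fun setT F ->
  power_integral m phi (F \o finv) = kappa^-1 * power_integral m phi F.
Proof.
move=> mphi phi0 mF.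
have mg : measurable_fun setT (fun y => (phi (F (finv y)))%:E).
  apply/measurable_EFinP; apply: measurableT_comp => //.
  exact: measurableT_comp.
have := ge0_integral_scaled_measure measurableT mg (fun y => phi0 _).
rewrite preimage_setT /power_integral; under eq_integral do rewrite fK.
by move=> ->; rewrite fine_pmul mulrA mulVf ?gt_eqF// mul1r.
Qed.

Lemma Lfun_scaled_measure (p : R) (phi : T -> R) : 1 <= p ->
  phi \in Lfun m p%:E -> (fun y => kappa * phi (finv y)) \in Lfun m p%:E.
Proof.
move=> p1 Lphi; have p0 : 0 < p by apply: lt_le_trans p1.
have mphi : measurable_fun setT phi by have := sub_Lfun_mfun Lphi; rewrite inE.
have : (Lnorm m p%:E (EFin \o phi) < +oo)%E.
  by have := sub_Lfun_finLfun Lphi; rewrite inE.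
have mphif : measurable_fun setT (phi \o finv) by exact: measurableT_comp.
move=> phioo; rewrite inE; apply/andP; split; rewrite inE /=.
  by apply: measurable_funM.
rewrite /finite_norm (Lnorm_scale m p1)// lte_mul_pinfty//.
rewrite unlock /= in phioo *.
apply: poweR_lty; have pV0 : p^-1 != 0 by rewrite gt_eqF// invr_gt0.
have {}phioo := lty_poweRy pV0 phioo.
have mg : measurable_fun setT (fun y => (`|phi (finv y)| `^ p)%:E).
  apply/measurable_EFinP; apply: measurableT_comp (measurable_powR _) _.
  exact: measurableT_comp.
have := ge0_integral_scaled_measure measurableT mg (fun y => powR_ge0 _ _).
rewrite preimage_setT; under eq_integral do rewrite fK.
move=> E; rewrite ltey; apply: contraTneq phioo => Foo.
by rewrite -leNgt leye_eq; apply/eqP; rewrite E Foo gt0_muley.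
Qed.

End scaled_measures.

Section image_fields.
Context (R : realType) (d : nat).
Local Notation E := (d.-tuple R).
Local Notation lambda := (lebesgue_tuple R d).
Variables (f : {mfun E >-> E}) (finv : E -> E) (kappa : R).
Hypotheses (kappa0 : 0 < kappa) (mfinv : measurable_fun setT finv).
Hypothesis fK : cancel f finv.
Hypothesis flambda : forall A, measurable A ->
  lambda (f @^-1` A) = (kappa%:E * lambda A)%E.

Lemma has_density_image (alpha : R) mu (phi : E -> R) : 1 <= alpha ->
  has_density alpha mu phi ->
  has_density alpha (charge_image f mu) (fun y => kappa * phi (finv y)).
Proof.
move=> a1 [L1 La muE]; split.
- exact: Lfun_scaled_measure.
- exact: Lfun_scaled_measure.
move=> A mA.
have mf : measurable_fun setT f by exact: measurable_funPT.
have mfA : measurable (f @^-1` A) by rewrite -[X in measurable X]setTI; exact: mf.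
have L1' := Lfun_scaled_measure kappa0 mfinv fK flambda (lexx 1) L1.
have int1 : lambda.-integrable setT (EFin \o (fun y => kappa * phi (finv y))).
  exact/Lfun1_integrable.
have mphi : measurable_fun setT (fun y => kappa * phi (finv y)).
  by have := sub_Lfun_mfun L1'; rewrite inE.
have k0 : kappa != 0 by rewrite gt_eqF.
have phiE : phi \o finv = (fun y => kappa^-1 * (kappa * phi (finv y))).
  by apply/funext => y; rewrite mulrA mulVf// mul1r.
have int2 : lambda.-integrable setT (EFin \o (phi \o finv)).
  by rewrite phiE; exact: (integrableZl measurableT kappa^-1 int1).
have intA : lambda.-integrable A (EFin \o (phi \o finv)).
  by apply: integrableS int2.
transitivity (mu (f @^-1` A)) => //; rewrite muE//.
transitivity (\int[lambda]_(x in f @^-1` A) (EFin \o (phi \o finv)) (f x))%E.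
  by apply: eq_integral => x _; rewrite /= fK.
have m2 := measurable_int _ int2.
rewrite (integral_scaled_measure kappa0 flambda mA m2 intA).
by rewrite -integralZl.
Qed.

(** Both sides have the masses of H = sum_i theta_i phi_i multiplied by
    kappa^(gamma - 1): on the left kappa^gamma from homogeneity and kappa^-1 from
    the change of variables, on the right s^gamma with s = kappa^(1 - 1 / gamma). *)
Lemma image_same_fdd (alpha gamma b sigma : R) dO (Omega : measurableType dO)
    (P : probability Omega R) (M : set E -> {RV P >-> R})
    (Z : {charge set E -> \bar R} -> {RV P >-> R})
    (sigma0 : 0 <= sigma) (m := mscale (NngNum sigma0) lambda) :
  1 <= alpha -> 1 <= gamma -> stable_random_measure gamma b m M ->
  (forall mu phi, has_density alpha mu phi ->
     is_stable_integral gamma m M phi (Z mu)) ->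
  same_fdd P (L1_Lalpha alpha) (fun mu => Z (charge_image f mu))
    (fun mu w => kappa `^ (1 - gamma^-1) * Z mu w).
Proof.
move=> a1 g1 M_stable Z_integral n t Dt.
have g0 : 0 < gamma by apply: lt_le_trans g1.
have /choice[phi dphi] : forall i, exists phi, has_density alpha (t i) phi by exact: Dt.
have fm A : measurable A -> m (f @^-1` A) = (kappa%:E * m A)%E.
  by move=> mA; rewrite /m /mscale/= flambda// muleCA.
have Zt i := Z_integral _ _ (dphi i).
have Zft i := Z_integral _ _ (has_density_image a1 (dphi i)).
have mphi i : measurable_fun setT (phi i).
  by have [/sub_Lfun_mfun] := Zt i; rewrite inE.
apply: same_joint_law => [i|i|theta].
- exact: measurable_funPT.
- by apply: measurable_funM => //; exact: measurable_funPT.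
pose s := kappa `^ (1 - gamma^-1).
have s0 : 0 < s by exact: powR_gt0.
pose H x := \sum_(i < n) theta i * phi i x.
have mH : measurable_fun setT H by apply: measurable_sum => i; exact: measurable_funM.
have lawf := stable_integral_cos_law M_stable g1 theta Zft.
have law := stable_integral_cos_law M_stable g1 (fun i => theta i * s) Zt.
have HfE : (fun y => \sum_(i < n) theta i * (kappa * phi i (finv y))) =
    (fun y => kappa * H (finv y)).
  by apply/funext => y; rewrite mulr_sumr; apply: eq_bigr => i _; ring.
have HE : (fun x => \sum_(i < n) theta i * s * phi i x) = (fun x => s * H x).
  by apply/funext => x; rewrite mulr_sumr; apply: eq_bigr => i _; ring.
have powE (q : R -> R) : measurable_fun setT q -> (forall x, 0 <= q x) ->
    (forall a x, 0 < a -> q (a * x) = a `^ gamma * q x) ->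
    power_integral m q (fun y => kappa * H (finv y)) = power_integral m q (fun x => s * H x).
  move=> mq q0 qM.
  have scaleE a (F : E -> R) : 0 < a -> measurable_fun setT F ->
      power_integral m q (fun x => a * F x) = a `^ gamma * power_integral m q F.
    move=> a0 mF; rewrite /power_integral; under eq_integral do rewrite qM// EFinM.
    rewrite ge0_integralZl ?lee_fin ?powR_ge0//.
    - by rewrite fine_pmul// powR_gt0.
    - by apply/measurable_EFinP; apply: measurableT_comp.
    - by move=> x _; rewrite lee_fin.
  rewrite (scaleE kappa (H \o finv))//; last exact: measurableT_comp.
  rewrite (power_integral_scaled_measure kappa0 mfinv fK fm)// (scaleE s H)//.
  rewrite mulrA; congr (_ * _).
  rewrite /s -powRrM mulrBl mul1r mulVf ?gt_eqF// powRB; last by rewrite (gt_eqF kappa0) implybT.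
  by rewrite powRr1// ltW.
have maxM a x : 0 < a -> Num.max (a * x) 0 `^ gamma = a `^ gamma * Num.max x 0 `^ gamma.
  move=> a_gt0; have -> : Num.max (a * x) 0 = a * Num.max x 0.
    by rewrite maxr_pMr ?mulr0// ltW.
  by rewrite powRM ?(ltW a_gt0)// le_max lexx orbT.
have mmax (g : R -> R) : measurable_fun setT g ->
    measurable_fun setT (fun x => Num.max (g x) 0 `^ gamma).
  move=> mg; apply: measurableT_comp (measurable_powR _) _.
  exact: measurable_maxr.
have posE : power_integral m (pos_power gamma) (fun y => kappa * H (finv y)) =
    power_integral m (pos_power gamma) (fun x => s * H x).
  apply: powE => [||a x]; [exact: (mmax id)|by move=> x; exact: powR_ge0|exact: maxM].
have negE : power_integral m (neg_power gamma) (fun y => kappa * H (finv y)) =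
    power_integral m (neg_power gamma) (fun x => s * H x).
  apply: powE => [||a x a_gt0]; [exact: (mmax -%R)|by move=> x; exact: powR_ge0|].
  by rewrite /neg_power -mulrN maxM.
rewrite HfE posE negE in lawf; rewrite HE in law.
eexists; eexists; split; first exact: lawf.
rewrite (_ : (fun w => _) = (fun w => \sum_(i < n) theta i * s * Z (t i) w)).
  exact: law.
by apply/funext => w; apply: eq_bigr => i _; rewrite mulrA.
Qed.

End image_fields.

Lemma translationNK (R : realType) d (s : d.-tuple R) :
  cancel (translation s) (translation (dilation (-1) s)).
Proof. by move=> x; apply/eq_from_tnth => i; rewrite !tnth_mktuple mulN1r addrK. Qed.

Lemma dilationK (R : realType) d (a : R) : a != 0 ->
  cancel (@dilation R d a) (dilation a^-1).
Proof. by move=> a0 x; apply/eq_from_tnth => i; rewrite !tnth_mktuple mulKf. Qed.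

Lemma lebesgue_tuple_dilation (R : realType) d (a : R) (A : set (d.-tuple R)) :
  0 < a -> measurable A ->
  lebesgue_tuple R d (dilation a @^-1` A) = ((a ^- d)%:E * lebesgue_tuple R d A)%E.
Proof.
move=> a0 mA; rewrite (lebesgue_tuple_affine [tuple 0 | i < d] a0 mA) muleA -EFinM.
rewrite mulVf ?expf_neq0 ?gt_eqF// mul1e.
congr (lebesgue_tuple R d (_ @^-1` A)); apply/funext => x; apply/eq_from_tnth => i.
by rewrite !tnth_mktuple addr0.
Qed.

Theorem proposition2p17
  (R : realType) (d : nat) (alpha beta gamma C_beta : R) (G : probability R R)
  (dO : measure_display) (Omega : measurableType dO) (P : probability Omega R)
  (M : set (d.-tuple R) -> {RV P >-> R})
  (Z : {charge set (d.-tuple R) -> \bar R} -> {RV P >-> R})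
  (d_ge1 : (1 <= d)%N)
  (alpha_itv : 1 < alpha <= 2)
  (beta_itv : d%:R < beta < alpha * d%:R)
  (gammaE : gamma = beta / d%:R)
  (C_beta_gt0 : 0 < C_beta)
  (G_attraction : normal_domain_of_attraction alpha G)
  (sigma_gamma_gt0 : 0 < sigma_gamma d C_beta gamma G)
  (b_gamma_itv : -1 <= b_gamma gamma G <= 1)
  (M_stable : stable_random_measure gamma (b_gamma gamma G)
     (control_measure d C_beta gamma G) M)
  (Z_integral : forall mu phi, has_density alpha mu phi ->
     is_stable_integral gamma (control_measure d C_beta gamma G) M phi (Z mu)) :
  [/\ stationary (L1_Lalpha alpha) Z,
      isotropic (L1_Lalpha alpha) Z &
      self_similar (L1_Lalpha alpha) Z ((d%:R - beta) / gamma)].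
Proof.
have d0 : 0 < d%:R :> R by rewrite ltr0n.
have /andP[d_beta _] := beta_itv; have /andP[/ltW alpha1 _] := alpha_itv.
have gamma1 : 1 <= gamma by rewrite gammaE ler_pdivlMr// mul1r ltW.
have gamma0 : 0 < gamma by apply: lt_le_trans gamma1.
have image f finv kappa kappa0 mfinv fK fm :=
  @image_same_fdd R d f finv kappa kappa0 mfinv fK fm alpha gamma _ _
    _ _ P M Z (powR_ge0 _ _) alpha1 gamma1 M_stable Z_integral.
split.
- move=> s n t Dt B mB.
  have fm A : measurable A ->
      lebesgue_tuple R d (translation s @^-1` A) = (1%:E * lebesgue_tuple R d A)%E.
    by move=> mA; rewrite mul1e lebesgue_tuple_translation.
  rewrite (image _ _ _ ltr01 (measurable_translation _) (translationNK s) fm n t Dt B mB).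
  by congr (joint_law _ _ B); apply/funext => i; apply/funext => w; rewrite powR1 mul1r.
- move=> Theta orthTheta n t Dt B mB.
  have fm A : measurable A ->
      lebesgue_tuple R d (mx_map Theta @^-1` A) = (1%:E * lebesgue_tuple R d A)%E.
    by move=> mA; rewrite mul1e lebesgue_tuple_orthogonal.
  rewrite (image _ _ _ ltr01 (measurable_mx_map _) (orthogonalK orthTheta) fm n t Dt B mB).
  by congr (joint_law _ _ B); apply/funext => i; apply/funext => w; rewrite powR1 mul1r.
- move=> a a0 n t Dt B mB.
  have k0 : 0 < a ^- d by rewrite invr_gt0 exprn_gt0.
  have aN0 : a != 0 by rewrite gt_eqF.
  have fm A : measurable A ->
      lebesgue_tuple R d (dilation a @^-1` A) = ((a ^- d)%:E * lebesgue_tuple R d A)%E.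
    exact: lebesgue_tuple_dilation.
  rewrite (image _ _ _ k0 (measurable_dilation _) (dilationK aN0) fm n t Dt B mB).
  suff -> : (a ^- d) `^ (1 - gamma^-1) = a `^ ((d%:R - beta) / gamma) by [].
  rewrite -powR_invn ?(ltW a0)// -powRrM; congr (_ `^ _).
  have dN0 : d%:R != 0 :> R by rewrite gt_eqF.
  have bN0 : beta != 0 by rewrite gt_eqF// (lt_trans d0).
  by rewrite gammaE; field; rewrite bN0 dN0.
Qed.
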